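(* Let $\mathcal{A}$ and $\mathcal{B}$ be operator $*$-algebras, let $\mathcal{X}$ be an operator $*$-correspondence from $\mathcal{A}$ to $\mathcal{B}$, and let $\pi=(H_\pi,U,\pi_{\mathcal{A}},\pi_{\mathcal{B}},\pi_{\mathcal{X}})$ be a standard form representation of $\mathcal{X}$, with linking algebra $\mathscr{L}_\pi(\mathcal{X})\subseteq B(H_\pi\oplus H_\pi)$. The involution $$\begin{pmatrix}\pi(b)&\pi(y^\dagger)\\\pi(x)&\pi(a)+\pi(K)\end{pmatrix}^\dagger:=\begin{pmatrix}U&0\\0&U\end{pmatrix}\begin{pmatrix}\pi(b)&\pi(y^\dagger)\\\pi(x)&\pi(a)+\pi(K)\end{pmatrix}^*\begin{pmatrix}U&0\\0&U\end{pmatrix}$$ ($a\in\mathcal{A}$, $b\in\mathcal{B}$, $x,y\in\mathcal{X}$, $K\in\mathbb{K}(\mathcal{X})$) makes the linking algebra $\mathscr{L}_\pi(\mathcal{X})$ into an operator $*$-algebra. The triple $\left(H_\pi\oplus H_\pi,\ \iota,\ \begin{pmatrix}U&0\\0&U\end{pmatrix}\right)$, where $\iota:\mathscr{L}_\pi(\mathcal{X})\to B(H_\pi\oplus H_\pi)$ denotes the inclusion, is a standard form representation of $\mathscr{L}_\pi(\mathcal{X})$.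
   Context: An operator space is a complex vector space $\mathcal{X}$ with norms on all $M_n(\mathcal{X})$ such that $\mathcal{X}$ is complete, $\|\lambda\xi\mu\|\le\|\lambda\|\|\xi\|\|\mu\|$ for scalar matrices $\lambda,\mu$, and $\|\xi\oplus\eta\|=\max\{\|\xi\|,\|\eta\|\}$. A linear map is completely bounded if the entrywise induced maps on all $M_n$ are bounded by a common constant; a cb-isomorphism is completely bounded with completely bounded inverse. An operator algebra is an operator space that is an algebra with $\|xy\|\le\|x\|\|y\|$ on all $M_n$; an operator $*$-algebra is an operator algebra that is a $*$-algebra with involution $\dagger$ such that $\|x^\dagger\|=\|x\|$ on all $M_n$, $(x^\dagger)_{ij}=(x_{ji})^\dagger$. A standard form representation of an operator $*$-algebra $\mathcal{L}$ consists of a Hilbert space $H$, a selfadjoint unitary $u\in B(H)$ and a completely bounded algebra homomorphism $\pi$ of $\mathcal{L}$ onto a closed subalgebra of $B(H)$ with completely bounded inverse, such that $\pi(a)^*=u\pi(a^\dagger)u$ for all $a\in\mathcal{L}$. An operator $*$-correspondence from $\mathcal{A}$ to $\mathcal{B}$ is an operator space $\mathcal{X}$ that is an $\mathcal{A}$-$\mathcal{B}$-bimodule with $\|a\xi\|\le\|a\|\|\xi\|$, $\|\xi b\|\le\|\xi\|\|b\|$ on all $M_n$, and a pairing $\langle\cdot,\cdot\rangle:\mathcal{X}\times\mathcal{X}\to\mathcal{B}$, linear in the second variable, with $\langle\xi,\eta b\rangle=\langle\xi,\eta\rangle b$, $\langle\xi,\eta\rangle=\langle\eta,\xi\rangle^\dagger$,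 $\langle a\xi,\eta\rangle=\langle\xi,a^\dagger\eta\rangle$, and $\|\langle\xi,\eta\rangle\|\le\|\xi\|\|\eta\|$ on all $M_n(\mathcal{X})$, where $\langle\xi,\eta\rangle_{ij}=\sum_k\langle\xi_{ki},\eta_{kj}\rangle$. A standard form representation of $\mathcal{X}$ is a quintuple $(H_\pi,U,\pi_{\mathcal{A}},\pi_{\mathcal{B}},\pi_{\mathcal{X}})$: $H_\pi$ a Hilbert space, $U\in B(H_\pi)$ a selfadjoint unitary, $\pi_{\mathcal{A}},\pi_{\mathcal{B}}$ completely bounded algebra homomorphisms into $B(H_\pi)$ and $\pi_{\mathcal{X}}:\mathcal{X}\to B(H_\pi)$ a completely bounded linear map, all three being cb-isomorphisms onto their (closed) images, with $\pi_{\mathcal{X}}(xb)=\pi_{\mathcal{X}}(x)\pi_{\mathcal{B}}(b)$, $\pi_{\mathcal{X}}(ax)=\pi_{\mathcal{A}}(a)\pi_{\mathcal{X}}(x)$, $U\pi_{\mathcal{A}}(a)^*U=\pi_{\mathcal{A}}(a^\dagger)$, $U\pi_{\mathcal{B}}(b)^*U=\pi_{\mathcal{B}}(b^\dagger)$, $U\pi_{\mathcal{X}}(x)^*U\pi_{\mathcal{X}}(y)=\pi_{\mathcal{B}}(\langle x,y\rangle)$. The adjoint module $\mathcal{X}^\dagger=\{\xi^\dagger\}$ is the conjugate vector space with $\|\xi^\dagger\|:=\|\xi\|$, $(\xi^\dagger)_{ij}=(\xi_{ji})^\dagger$ and left action $b\xi^\dagger=(\xi b^\dagger)^\dagger$.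 $\mathbb{K}(\mathcal{X})=\mathcal{X}\,\widetilde\otimes_{\mathcal{B}}\,\mathcal{X}^\dagger$ is the balanced Haagerup tensor product: the completion of the algebraic tensor product $\mathcal{X}\otimes\mathcal{X}^\dagger$ in the norms $\|z\|=\inf\{\|x\|\|y\|\mid z=x\otimes y,\ x\in M_{n,m}(\mathcal{X}),y\in M_{m,n}(\mathcal{X}^\dagger)\}$, $(x\otimes y)_{ij}=\sum_kx_{ik}\otimes y_{kj}$, modulo the closed span of all $xb\otimes y-x\otimes by$. It is an operator $*$-algebra with $(\xi_0\otimes\eta_0^\dagger)(\xi_1\otimes\eta_1^\dagger)=\xi_0\langle\eta_0,\xi_1\rangle\otimes\eta_1^\dagger$ and $(\xi_0\otimes\eta_0^\dagger)^\dagger=\eta_0\otimes\xi_0^\dagger$. Put $\pi_{\mathcal{X}^\dagger}(x^\dagger):=U\pi_{\mathcal{X}}(x)^*U$ and let $\pi_{\mathbb{K}(\mathcal{X})}:\mathbb{K}(\mathcal{X})\to B(H_\pi)$ be the completely bounded algebra homomorphism with $\pi_{\mathbb{K}(\mathcal{X})}(x\otimes y^\dagger)=\pi_{\mathcal{X}}(x)\pi_{\mathcal{X}^\dagger}(y^\dagger)$. Subscripts on $\pi$ are omitted in the claim. The linking algebra $\mathscr{L}_\pi(\mathcal{X})$ is the operator norm closure in $B(H_\pi\oplus H_\pi)$ of the subalgebra $$\begin{pmatrix}\pi_{\mathcal{B}}(\mathcal{B})&\pi_{\mathcal{X}^\dagger}(\mathcal{X}^\dagger)\\\pi_{\mathcal{X}}(\mathcal{X})&\pi_{\mathcal{A}}(\mathcal{A})+\pi_{\mathbb{K}(\mathcal{X})}(\mathbb{K}(\mathcal{X}))\end{pmatrix};$$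 the involution in the claim is given on this dense subalgebra and extends to the closure by the same formula. *)

(* Defs.v *)
From HB Require Import structures.
From mathcomp Require Import all_boot all_order all_algebra.
From mathcomp Require Import generic_quotient sesquilinear complex.
From mathcomp Require Import ring lra.
From mathcomp Require Import all_classical all_reals.
Set Implicit Arguments.
Unset Strict Implicit.
Unset Printing Implicit Defensive.
Import Order.TTheory GRing.Theory Num.Theory.
Local Open Scope ring_scope.
Local Open Scope classical_set_scope.
Local Open Scope quotient_scope.

(* Matrix product along an arbitrary pairing of entries. *)
Definition mxprod (U V : Type) (Z : nmodType) (f : U -> V -> Z)
    (m n p : nat) (x : 'M[U]_(m, n)) (y : 'M[V]_(n, p)) : 'M[Z]_(m, p) :=
  \matrix_(i, j) \sum_k f (x i k) (y k j).
Arguments mxprod {U V Z} f {m n p} x y.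

Section Norms.
Variable R : realType.

Definition seq_complete (V : zmodType) (nrm : V -> R) : Prop :=
  forall u : nat -> V,
    (forall e : R, 0 < e -> exists k, forall m n,
        (k <= m)%N -> (k <= n)%N -> nrm (u m - u n) < e) ->
    exists l, forall e : R, 0 < e -> exists k, forall n,
        (k <= n)%N -> nrm (u n - l) < e.

Definition norm_closure (V : zmodType) (nrm : V -> R) (S : set V) : set V :=
  [set x | forall e : R, 0 < e -> exists2 y, S y & nrm (x - y) < e].
End Norms.

Definition hnorm (R : realType) (H : lmodType R[i]) (ip : {dot H for Num.conj})
  (x : H) : R := Num.sqrt (complex.Re (ip x x)).

(* Inner products are linear in the first variable, as in [sesquilinear]. *)
Record hilbert (R : realType) := Hilbert {
  hs_car :> lmodType R[i];
  hs_ip : {dot hs_car for Num.conj};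
  hs_complete : seq_complete (hnorm hs_ip)
}.

Section BoundedOperators.
Variables (R : realType) (H : hilbert R).
Notation ip := (hs_ip H).
Notation hn := (hnorm ip).

Definition bounded_linear : {pred H -> H} :=
  fun T => `[< linear T /\ exists c : R, forall x, hn (T x) <= c * hn x >].

Lemma bounded_linearP (T : H -> H) :
  T \in bounded_linear <->
  linear T /\ exists2 c : R, 0 <= c &
    forall x, complex.Re (ip (T x) (T x)) <= c * complex.Re (ip x x).
Proof.
have rge0 x : 0 <= complex.Re (ip x x).
  by have := dnorm_ge0 ip x; rewrite lecE => /andP[].
split=> [/asboolP[lT [c cT]]|[lT [c c0 cT]]]; last first.
  apply/asboolP; split=> //; exists (Num.sqrt c) => x.
  by rewrite /hnorm -sqrtrM// ler_wsqrtr.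
split=> //; exists (c ^+ 2) => [|x]; first exact: sqr_ge0.
rewrite -[leLHS]sqr_sqrtr// -[in leRHS](sqr_sqrtr (rge0 x)) -exprMn.
have := cT x; rewrite /hnorm => /(lerXn2r 2); apply.
  by rewrite nnegrE sqrtr_ge0.
by rewrite nnegrE (le_trans _ (cT x)) ?sqrtr_ge0.
Qed.

Lemma ip_parallelogram (x y : H) : complex.Re (ip (x + y) (x + y)) <=
  2 * complex.Re (ip x x) + 2 * complex.Re (ip y y).
Proof.
have : 0 <= complex.Re (ip (x - y) (x - y)).
  by have := dnorm_ge0 ip (x - y); rewrite lecE => /andP[].
rewrite dnormB dnormD !raddfD/= raddfN/=.
by lra.
Qed.

Lemma bounded_linear_closed : subsemimod_closed bounded_linear.
Proof.
split; first split.
- apply/bounded_linearP; split=> [a x y|]; first by rewrite scaler0 addr0.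
  by exists 0 => // x; rewrite linear0l mul0r.
- move=> S T /bounded_linearP[lS [c c0 cS]] /bounded_linearP[lT [d d0 dT]].
  apply/bounded_linearP; split=> [a x y|].
    by rewrite ![(S + T) _]/GRing.add/= lS lT scalerDr addrACA.
  exists (2 * c + 2 * d) => [|x]; first by lra.
  apply: (le_trans (ip_parallelogram _ _)).
  by have := cS x; have := dT x; lra.
- move=> a T /bounded_linearP[lT [c c0 cT]].
  apply/bounded_linearP; split=> [b x y|].
    change (a *: T (b *: x + y) = b *: (a *: T x) + a *: T y).
    by rewrite lT scalerDr !scalerA mulrC.
  have na0 : 0 <= complex.Re (a * a^*).
    by have := mul_conjC_ge0 a; rewrite lecE => /andP[].
  exists (complex.Re (a * a^*) * c) => [|x]; first exact: mulr_ge0.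
  change (complex.Re (ip (a *: T x) (a *: T x)) <=
    complex.Re (a * a^*) * c * complex.Re (ip x x)).
  rewrite /= linearZl_LR linearZr_LR/= mulrA.
  have ia : complex.Im (a * a^*) = 0.
    by have := mul_conjC_ge0 a; rewrite lecE => /andP[/eqP ? _].
  have -> z : complex.Re (a * a^* * z) = complex.Re (a * a^*) * complex.Re z.
    by move: (a * a^*) ia => [p q] /= ->; case: z => r s /=; rewrite mul0r subr0.
  by rewrite -mulrA ler_wpM2l.
Qed.

HB.instance Definition _ :=
  GRing.isSubSemiModClosed.Build R[i] (H -> H) bounded_linear
    bounded_linear_closed.

Record BL := MkBL { bl_fun :> H -> H; bl_funP : bl_fun \in bounded_linear }.

HB.instance Definition _ := [isSub for bl_fun].
HB.instance Definition _ := [Choice of BL by <:].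
HB.instance Definition _ := [SubChoice_isSubLmodule of BL by <:].

Lemma bl_linear (T : BL) : linear T.
Proof. by have /bounded_linearP[] := bl_funP T. Qed.

Lemma bl_bound (T : BL) : exists2 c : R, 0 <= c &
  forall x, complex.Re (ip (T x) (T x)) <= c * complex.Re (ip x x).
Proof. by have /bounded_linearP[] := bl_funP T. Qed.

Fact bl_id_subproof : idfun \in bounded_linear.
Proof. by apply/asboolP; split=> //; exists 1 => x; rewrite mul1r. Qed.

Definition bl_id : BL := MkBL bl_id_subproof.

Fact bl_comp_subproof (S T : BL) : (S \o T) \in bounded_linear.
Proof.
apply/bounded_linearP; split=> [a x y|]; first by rewrite /= !bl_linear.
have [c c0 cS] := bl_bound S; have [d d0 dT] := bl_bound T.
exists (c * d) => [|x]; first exact: mulr_ge0.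
by rewrite /= (le_trans (cS _))// -mulrA ler_wpM2l.
Qed.

Definition bl_comp (S T : BL) : BL := MkBL (bl_comp_subproof S T).

(* The Hilbert space adjoint: by the Riesz representation theorem there is
   exactly one such S, so the default value 0 is never taken. *)
Definition adjoint (T : BL) : BL :=
  xget 0 [set S : BL | forall x y, ip (T x) y = ip x (S y)].

Definition selfadjoint_unitary (U : BL) : Prop :=
  adjoint U = U /\ bl_comp U U = bl_id.

(* The norm of M_n(B(H)) = B(H^n). *)
Definition vec_norm n (v : 'cV[H]_n) : R :=
  Num.sqrt (\sum_i hn (v i 0) ^+ 2).

Definition bl_mxnorm n (T : 'M[BL]_n) : R :=
  sup [set vec_norm (mxprod (fun (S : BL) x => S x) T v) |
        v in [set v : 'cV[H]_n | vec_norm v <= 1]].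

End BoundedOperators.

Arguments bl_mxnorm {R} H n T.

Section DirectSum.
Variables (R : realType) (H : hilbert R).
Notation ip := (hs_ip H).

Definition dsum_ip (x y : H * H) : R[i] := ip x.1 y.1 + ip x.2 y.2.

Fact dsum_ip_bilinear :
  bilinear_for *%R (Num.conj \; *%R) dsum_ip.
Proof.
split=> z a x y; rewrite /dsum_ip /=.
  by rewrite !linearDl/= !linearZl_LR mulrDr addrACA.
by rewrite !raddfD/= !linearZr_LR mulrDr addrACA.
Qed.

HB.instance Definition _ :=
  bilinear_isBilinear.Build R[i] (H * H)%type (H * H)%type R[i] *%R (Num.conj \; *%R)
    dsum_ip dsum_ip_bilinear.

Fact dsum_ip_herm (x y : H * H) :
  dsum_ip x y = (-1) ^+ false * Num.conj (dsum_ip y x).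
Proof.
rewrite expr0 mul1r /dsum_ip rmorphD/=.
by rewrite (hermC ip x.1) (hermC ip x.2) /= expr0 !mul1r.
Qed.

HB.instance Definition _ := isHermitianSesquilinear.Build R[i] (H * H)%type false Num.conj
  dsum_ip dsum_ip_herm.

Fact dsum_ip_gt0 (u : H * H) : u != 0 -> 0 < dsum_ip u u.
Proof.
move=> u0; rewrite lt_neqAle eq_sym addr_ge0 ?dnorm_ge0// andbT.
apply: contra u0; rewrite paddr_eq0 ?dnorm_ge0// !dnorm_eq0.
by case: u => u1 u2 /= /andP[/eqP-> /eqP->].
Qed.

HB.instance Definition _ := isDotProduct.Build R[i] (H * H)%type dsum_ip dsum_ip_gt0.

Definition dsum_dot : {dot (H * H)%type for Num.conj} := dsum_ip.

Fact dsum_complete : seq_complete (hnorm dsum_dot).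
Proof.
have rge0 (z : H) : 0 <= complex.Re (ip z z).
  by have := dnorm_ge0 ip z; rewrite lecE => /andP[].
move=> u cu.
have cauchy (p : H * H -> H) : (forall x y, p (x - y) = p x - p y) ->
    (forall x, hnorm ip (p x) <= hnorm dsum_dot x) ->
    exists l, forall e : R, 0 < e -> exists k, forall n,
      (k <= n)%N -> hnorm ip (p (u n) - l) < e.
  move=> pB ple; apply: (@hs_complete _ H (p \o u)) => e /cu[k uk].
  by exists k => m n km kn; rewrite /= -pB (le_lt_trans (ple _))// uk.
have [|x|l1 l1P] := cauchy (@fst H H); first by case=> ? ? [].
  by apply: ler_wsqrtr; rewrite /= /dsum_ip raddfD/= lerDl.
have [|x|l2 l2P] := cauchy (@snd H H); first by case=> ? ? [].
  by apply: ler_wsqrtr; rewrite /= /dsum_ip raddfD/= lerDr.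
exists (l1, l2) => e e0; have e20 : 0 < e / 2 by rewrite divr_gt0.
have [k1 k1P] := l1P _ e20; have [k2 k2P] := l2P _ e20.
exists (maxn k1 k2) => n; rewrite geq_max => /andP[kn1 kn2].
have {k1P}h1 := k1P n kn1; have {k2P}h2 := k2P n kn2.
have -> : e = Num.sqrt (e ^+ 2) by rewrite sqrtr_sqr gtr0_norm.
rewrite ltr_sqrt ?exprn_gt0//= /dsum_ip raddfD/=.
have sq (z : H) : hnorm ip z < e / 2 -> complex.Re (ip z z) < e ^+ 2 / 2.
  move=> hz; rewrite -(sqr_sqrtr (rge0 z)).
  have := sqrtr_ge0 (complex.Re (ip z z)).
  by rewrite -/(hnorm ip z); nra.
by have := sq _ h1; have := sq _ h2; lra.
Qed.

Definition dsum : hilbert R := Hilbert dsum_complete.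

Definition block_fun (T11 T12 T21 T22 : BL H) (x : dsum) : dsum :=
  (T11 x.1 + T12 x.2, T21 x.1 + T22 x.2).

Fact block_subproof T11 T12 T21 T22 :
  block_fun T11 T12 T21 T22 \in bounded_linear (H := dsum).
Proof.
apply/bounded_linearP; split=> [a x y|].
  by rewrite /block_fun /= !bl_linear; congr pair; rewrite /= scalerDr addrACA.
have rge0 (z : H) : 0 <= complex.Re (ip z z).
  by have := dnorm_ge0 ip z; rewrite lecE => /andP[].
have [a a0 Pa] := bl_bound T11; have [b b0 Pb] := bl_bound T12.
have [c c0 Pc] := bl_bound T21; have [d d0 Pd] := bl_bound T22.
exists (2 * (a + b + c + d)) => [|x]; first by lra.
rewrite /= /dsum_ip !raddfD/=.
have := ip_parallelogram (T11 x.1) (T12 x.2).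
have := ip_parallelogram (T21 x.1) (T22 x.2).
have := Pa x.1; have := Pb x.2; have := Pc x.1; have := Pd x.2.
have := rge0 x.1; have := rge0 x.2.
nra.
Qed.

Definition block_op T11 T12 T21 T22 : BL dsum :=
  MkBL (block_subproof T11 T12 T21 T22).
End DirectSum.

Definition matnorm (R : realType) (V : lmodType R[i]) := forall n, 'M[V]_n -> R.

Section OperatorSpaces.
Variable R : realType.
Notation C := R[i].

(* The l^2 norm on C^n and the operator norm of a rectangular scalar matrix. *)
Definition cvec_norm n (v : 'cV[C]_n) : R :=
  Num.sqrt (\sum_i Normc.normc (v i 0) ^+ 2).

Definition scalar_mxnorm m n (a : 'M[C]_(m, n)) : R :=
  sup [set cvec_norm (a *m v) | v in [set v : 'cV[C]_n | cvec_norm v <= 1]].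

Definition lscale (V : lmodType C) m n p (a : 'M[C]_(m, n)) (x : 'M[V]_(n, p)) :
  'M[V]_(m, p) := mxprod *:%R a x.

Definition rscale (V : lmodType C) m n p (x : 'M[V]_(m, n)) (a : 'M[C]_(n, p)) :
  'M[V]_(m, p) := mxprod (fun v c => c *: v) x a.

(* The norm of V itself, i.e. on 1 x 1 matrices. *)
Definition norm1 (V : lmodType C) (N : matnorm V) (v : V) : R :=
  N 1%N (const_mx v).

(* The norm of a rectangular matrix is that of a square zero padding. *)
Definition rect_norm (V : lmodType C) (N : matnorm V) m n (x : 'M[V]_(m, n)) : R :=
  N (m + n)%N (block_mx 0 x 0 0).

Record is_operator_space (V : lmodType C) (N : matnorm V) : Prop := {
  os_eq0 : forall n (x : 'M[V]_n), N n x = 0 -> x = 0;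
  os_homog : forall n (c : C) (x : 'M[V]_n),
    N n (map_mx ( *:%R c) x) = Normc.normc c * N n x;
  os_triangle : forall n (x y : 'M[V]_n), N n (x + y) <= N n x + N n y;
  os_complete : seq_complete (norm1 N);
  os_scale : forall m n (a : 'M[C]_(m, n)) (x : 'M[V]_n) (b : 'M[C]_(n, m)),
    N m (rscale (lscale a x) b) <= scalar_mxnorm a * N n x * scalar_mxnorm b;
  os_dsum : forall m n (x : 'M[V]_m) (y : 'M[V]_n),
    N (m + n)%N (block_mx x 0 0 y) = Num.max (N m x) (N n y)
}.

Record operatorSpace := OperatorSpace {
  os_car :> lmodType C;
  os_norm : matnorm os_car;
  os_axioms : is_operator_space os_norm
}.

Record is_operator_algebra (V : lmodType C) (N : matnorm V) (mul : V -> V -> V) :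
    Prop := {
  oa_space : is_operator_space N;
  oa_linear_l : forall y, linear (mul^~ y);
  oa_linear_r : forall x, linear (mul x);
  oa_mulA : associative mul;
  oa_norm : forall n (x y : 'M[V]_n), N n (mxprod mul x y) <= N n x * N n y
}.

Record is_operator_star_algebra (V : lmodType C) (N : matnorm V)
    (mul : V -> V -> V) (dag : V -> V) : Prop := {
  osa_algebra : is_operator_algebra N mul;
  osa_conj_linear : forall c x y, dag (c *: x + y) = c^* *: dag x + dag y;
  osa_dagK : involutive dag;
  osa_dagM : forall x y, dag (mul x y) = mul (dag y) (dag x);
  osa_norm_dag : forall n (x : 'M[V]_n), N n (map_mx dag x^T) = N n x
}.

Record operatorStarAlgebra := OperatorStarAlgebra {
  osa_car :> lmodType C;
  osa_norm : matnorm osa_car;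
  osa_mul : osa_car -> osa_car -> osa_car;
  osa_dag : osa_car -> osa_car;
  osa_axioms : is_operator_star_algebra osa_norm osa_mul osa_dag
}.

Definition completely_bounded (V W : lmodType C) (N : matnorm V) (N' : matnorm W)
    (f : V -> W) : Prop :=
  exists c : R, forall n (x : 'M[V]_n), N' n (map_mx f x) <= c * N n x.

(* Cb-isomorphism onto a closed subspace: [cbe_inv] is the complete
   boundedness of the inverse defined on the range of [f]. *)
Record cb_embedding (V W : lmodType C) (N : matnorm V) (N' : matnorm W)
    (f : V -> W) : Prop := {
  cbe_linear : linear f;
  cbe_bounded : completely_bounded N N' f;
  cbe_inj : injective f;
  cbe_inv : exists c : R, forall n (x : 'M[V]_n), N n x <= c * N' n (map_mx f x);
  cbe_closed : norm_closure (norm1 N') (range f) `<=` range f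
}.

Record is_standard_form_rep (L : operatorStarAlgebra) (H : hilbert R)
    (pi : L -> BL H) (u : BL H) : Prop := {
  sfr_unitary : selfadjoint_unitary u;
  sfr_embedding : cb_embedding (@osa_norm L) (bl_mxnorm H) pi;
  sfr_mul : forall a b, pi (osa_mul a b) = bl_comp (pi a) (pi b);
  sfr_adjoint : forall a,
    adjoint (pi a) = bl_comp u (bl_comp (pi (osa_dag a)) u)
}.

End OperatorSpaces.

Arguments osa_norm {R} o n x.
Arguments os_norm {R} o n x.

Section Correspondences.
Variable R : realType.

Record correspondence (A B : operatorStarAlgebra R) := Correspondence {
  oc_space :> operatorSpace R;
  oc_lact : A -> oc_space -> oc_space;
  oc_ract : oc_space -> B -> oc_space;
  oc_pair : oc_space -> oc_space -> B;
  oc_lact_linear_l : forall x, linear (oc_lact^~ x);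
  oc_lact_linear_r : forall a, linear (oc_lact a);
  oc_ract_linear_l : forall b, linear (oc_ract^~ b);
  oc_ract_linear_r : forall x, linear (oc_ract x);
  oc_lactA : forall a a' x, oc_lact (osa_mul a a') x = oc_lact a (oc_lact a' x);
  oc_ractA : forall x b b', oc_ract x (osa_mul b b') = oc_ract (oc_ract x b) b';
  oc_lract : forall a x b, oc_ract (oc_lact a x) b = oc_lact a (oc_ract x b);
  oc_lact_norm : forall n (a : 'M[A]_n) (x : 'M[oc_space]_n),
    os_norm oc_space n (mxprod oc_lact a x) <=
      osa_norm A n a * os_norm oc_space n x;
  oc_ract_norm : forall n (x : 'M[oc_space]_n) (b : 'M[B]_n),
    os_norm oc_space n (mxprod oc_ract x b) <=
      os_norm oc_space n x * osa_norm B n b;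
  oc_pair_linear : forall x, linear (oc_pair x);
  oc_pair_ract : forall x y b, oc_pair x (oc_ract y b) = osa_mul (oc_pair x y) b;
  oc_pair_dag : forall x y, oc_pair x y = osa_dag (oc_pair y x);
  oc_pair_lact : forall a x y,
    oc_pair (oc_lact a x) y = oc_pair x (oc_lact (osa_dag a) y);
  oc_pair_norm : forall n (x y : 'M[oc_space]_n),
    osa_norm B n (mxprod oc_pair x^T y) <=
      os_norm oc_space n x * os_norm oc_space n y
}.

Record standard_rep (A B : operatorStarAlgebra R) (X : correspondence A B) :=
    StandardRep {
  sr_H : hilbert R;
  sr_U : BL sr_H;
  sr_A : A -> BL sr_H;
  sr_B : B -> BL sr_H;
  sr_X : X -> BL sr_H;
  sr_unitary : selfadjoint_unitary sr_U;
  sr_A_embedding : cb_embedding (osa_norm A) (bl_mxnorm sr_H) sr_A;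
  sr_B_embedding : cb_embedding (osa_norm B) (bl_mxnorm sr_H) sr_B;
  sr_X_embedding : cb_embedding (os_norm X) (bl_mxnorm sr_H) sr_X;
  sr_A_mul : forall a a', sr_A (osa_mul a a') = bl_comp (sr_A a) (sr_A a');
  sr_B_mul : forall b b', sr_B (osa_mul b b') = bl_comp (sr_B b) (sr_B b');
  sr_ract : forall x b, sr_X (oc_ract x b) = bl_comp (sr_X x) (sr_B b);
  sr_lact : forall a x, sr_X (oc_lact a x) = bl_comp (sr_A a) (sr_X x);
  sr_A_dag : forall a,
    bl_comp sr_U (bl_comp (adjoint (sr_A a)) sr_U) = sr_A (osa_dag a);
  sr_B_dag : forall b,
    bl_comp sr_U (bl_comp (adjoint (sr_B b)) sr_U) = sr_B (osa_dag b);
  sr_pair : forall x y,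
    bl_comp (bl_comp sr_U (bl_comp (adjoint (sr_X x)) sr_U)) (sr_X y) =
      sr_B (oc_pair x y)
}.

End Correspondences.

Record conj_mod (X : Type) := Adj { unadj : X }.

Section ConjMod.
Variables (R : realType) (X : lmodType R[i]).

HB.instance Definition _ := [isNew for @unadj X].
HB.instance Definition _ := [Choice of conj_mod X by <:].

Definition conj_add (x y : conj_mod X) := Adj (unadj x + unadj y).
Definition conj_opp (x : conj_mod X) := Adj (- unadj x).
Definition conj_scale (c : R[i]) (x : conj_mod X) := Adj (c^* *: unadj x).

Fact conj_addA : associative conj_add.
Proof. by move=> x y z; rewrite /conj_add /= addrA. Qed.
Fact conj_addC : commutative conj_add.
Proof. by move=> x y; rewrite /conj_add addrC. Qed.
Fact conj_add0 : left_id (Adj 0) conj_add.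
Proof. by case=> x; rewrite /conj_add /= add0r. Qed.
Fact conj_addN : left_inverse (Adj 0) conj_opp conj_add.
Proof. by move=> x; rewrite /conj_add /= addNr. Qed.

HB.instance Definition _ := GRing.isZmodule.Build (conj_mod X) conj_addA conj_addC conj_add0 conj_addN.

Fact conj_scaleA a b v : conj_scale a (conj_scale b v) = conj_scale (a * b) v.
Proof. by rewrite /conj_scale /= scalerA -rmorphM. Qed.
Fact conj_scale1 : left_id 1 conj_scale.
Proof. by case=> x; rewrite /conj_scale rmorph1 scale1r. Qed.
Fact conj_scaleDr : right_distributive conj_scale +%R.
Proof. by move=> a x y; rewrite /conj_scale /= scalerDr. Qed.
Fact conj_scaleDl v : {morph conj_scale^~ v : a b / a + b}.
Proof. by move=> a b; rewrite /conj_scale /= rmorphD scalerDl. Qed.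

HB.instance Definition _ := GRing.Zmodule_isLmodule.Build R[i] (conj_mod X)
  conj_scaleA conj_scale1 conj_scaleDr conj_scaleDl.

Definition conj_norm (N : matnorm X) : matnorm (conj_mod X) :=
  fun n x => N n (map_mx (@unadj X) x^T).

End ConjMod.

Definition conj_lact (R : realType) (A B : operatorStarAlgebra R)
    (X : correspondence A B) (b : B) (y : conj_mod X) : conj_mod X :=
  Adj (oc_ract (unadj y) (osa_dag b)).

Section Tensor.
Variables (F : fieldType) (X Y : lmodType F).

(* Equality of the formal sums of elementary tensors in X (x) Y.  Scalars are
   absorbed in the factors, so finite sequences of pairs suffice. *)
Inductive tensor_eq : seq (X * Y) -> seq (X * Y) -> Prop :=
| TensorRefl s : tensor_eq s s
| TensorSym s t : tensor_eq s t -> tensor_eq t s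
| TensorTrans s t u : tensor_eq s t -> tensor_eq t u -> tensor_eq s u
| TensorCat s s' t t' :
    tensor_eq s s' -> tensor_eq t t' -> tensor_eq (s ++ t) (s' ++ t')
| TensorC s t : tensor_eq (s ++ t) (t ++ s)
| Tensor0 y : tensor_eq [:: (0, y)] [::]
| TensorDl x x' y : tensor_eq [:: (x + x', y)] [:: (x, y); (x', y)]
| TensorDr x y y' : tensor_eq [:: (x, y + y')] [:: (x, y); (x, y')]
| TensorZ a x y : tensor_eq [:: (a *: x, y)] [:: (x, a *: y)].

Definition tensor_eqb (s t : seq (X * Y)) : bool := `[< tensor_eq s t >].

Fact tensor_eqb_refl : reflexive tensor_eqb.
Proof. by move=> s; apply/asboolP; exact: TensorRefl. Qed.
Fact tensor_eqb_sym : symmetric tensor_eqb.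
Proof. by move=> s t; apply/asboolP/asboolP; exact: TensorSym. Qed.
Fact tensor_eqb_trans : transitive tensor_eqb.
Proof.
by move=> t s u /asboolP st /asboolP tu; apply/asboolP; exact: TensorTrans tu.
Qed.

Canonical tensor_equiv :=
  EquivRel tensor_eqb tensor_eqb_refl tensor_eqb_sym tensor_eqb_trans.

Definition tensor := {eq_quot tensor_equiv}.
HB.instance Definition _ := Choice.on tensor.
HB.instance Definition _ := EqQuotient.on tensor.

Lemma tensor_eqP s t : tensor_eq s t <-> \pi_tensor s = \pi_tensor t.
Proof. by split=> [st|/eqmodP/asboolP//]; apply/eqmodP/asboolP. Qed.

Lemma tensor_repr s : tensor_eq (repr (\pi_tensor s)) s.
Proof. by apply/tensor_eqP; rewrite reprK. Qed.

Definition tensor_add (s t : tensor) : tensor := \pi_tensor (repr s ++ repr t).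
Definition tensor_opp (s : tensor) : tensor := \pi_tensor [seq (- p.1, p.2) | p <- repr s].
Definition tensor_scale a (s : tensor) : tensor := \pi_tensor [seq (a *: p.1, p.2) | p <- repr s].

Definition tens (x : X) (y : Y) : tensor := \pi_tensor [:: (x, y)].

Fact tensor_addE s t : tensor_add (\pi_tensor s) (\pi_tensor t) = \pi_tensor (s ++ t).
Proof. by apply/tensor_eqP; apply: TensorCat; apply: tensor_repr. Qed.

Lemma tensor_eq_scale a s t : tensor_eq s t ->
  tensor_eq [seq (a *: p.1, p.2) | p <- s] [seq (a *: p.1, p.2) | p <- t].
Proof.
elim=> {s t} /=.
- by move=> s; apply: TensorRefl.
- by move=> s t _; apply: TensorSym.
- by move=> s t u _ st _; apply: TensorTrans.
- by move=> s s' t t' _ ? _ ?; rewrite !map_cat; apply: TensorCat.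
- by move=> s t; rewrite !map_cat; apply: TensorC.
- by move=> y; rewrite scaler0; apply: Tensor0.
- by move=> x x' y; rewrite scalerDr; apply: TensorDl.
- by move=> *; apply: TensorDr.
- by move=> b x y; rewrite scalerA mulrC -scalerA; apply: TensorZ.
Qed.

Fact tensor_scaleE a s :
  tensor_scale a (\pi_tensor s) = \pi_tensor [seq (a *: p.1, p.2) | p <- s].
Proof. by apply/tensor_eqP/tensor_eq_scale/tensor_repr. Qed.

Fact tensor_oppE s : tensor_opp s = tensor_scale (-1) s.
Proof.
by congr \pi_tensor; apply: eq_map => -[x y]; rewrite scaleN1r.
Qed.

Fact tensor_piP (P : tensor -> Prop) : (forall s, P (\pi_tensor s)) -> forall t, P t.
Proof. by move=> H t; rewrite -[t]reprK. Qed.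

Fact tensor_addA : associative tensor_add.
Proof. by elim/tensor_piP=> s; elim/tensor_piP=> t; elim/tensor_piP=> u; rewrite !tensor_addE catA. Qed.
Fact tensor_addC : commutative tensor_add.
Proof.
by elim/tensor_piP=> s; elim/tensor_piP=> t; rewrite !tensor_addE; apply/tensor_eqP/TensorC.
Qed.
Fact tensor_add0 : left_id (\pi_tensor [::]) tensor_add.
Proof. by elim/tensor_piP=> s; rewrite tensor_addE. Qed.

Fact tensor_scaleDr : right_distributive tensor_scale tensor_add.
Proof.
by move=> a; elim/tensor_piP=> s; elim/tensor_piP=> t; rewrite !(tensor_addE, tensor_scaleE) map_cat.
Qed.

Fact tensor_scaleDl v : {morph tensor_scale^~ v : a b / a + b >-> tensor_add a b}.
Proof.
elim/tensor_piP: v => s a b; rewrite !tensor_scaleE tensor_addE.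
elim: s => [//|[x y] s IH] /=.
rewrite -cat1s -tensor_addE {}IH tensor_addE scalerDl.
apply/tensor_eqP; apply: (TensorTrans (TensorCat (TensorDl _ _ _) (TensorRefl _))).
set p := (a *: x, y); set q := (b *: x, y); set Sa := map _ s; set Sb := map _ s.
change (tensor_eq ([:: p] ++ ([:: q] ++ (Sa ++ Sb)))
                  ([:: p] ++ (Sa ++ ([:: q] ++ Sb)))).
apply: TensorCat; first exact: TensorRefl.
rewrite !catA; apply: TensorCat; last exact: TensorRefl.
exact: TensorC.
Qed.

Fact tensor_scale0 s : tensor_scale 0 s = \pi_tensor [::].
Proof.
elim/tensor_piP: s => s; rewrite tensor_scaleE; apply/tensor_eqP.
elim: s => [|[x y] s IH] /=; first exact: TensorRefl.
rewrite scale0r -cat1s -[[::]]cat0s; apply: TensorCat => //; exact: Tensor0.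
Qed.

Fact tensor_scale1 : left_id 1 tensor_scale.
Proof.
by elim/tensor_piP=> s; rewrite tensor_scaleE; congr \pi_tensor; apply: map_id_in => -[x y] _;
  rewrite scale1r.
Qed.

Fact tensor_addN : left_inverse (\pi_tensor [::]) tensor_opp tensor_add.
Proof.
by move=> s; rewrite tensor_oppE -[X in tensor_add _ X]tensor_scale1 -tensor_scaleDl addNr tensor_scale0.
Qed.

Fact tensor_scaleA a b v : tensor_scale a (tensor_scale b v) = tensor_scale (a * b) v.
Proof.
elim/tensor_piP: v => s; rewrite !tensor_scaleE -map_comp; congr \pi_tensor.
by apply: eq_map => -[x y]; rewrite /= scalerA.
Qed.

HB.instance Definition _ := GRing.isZmodule.Build tensor tensor_addA tensor_addC tensor_add0 tensor_addN.
HB.instance Definition _ := GRing.Zmodule_isLmodule.Build F tensor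
  tensor_scaleA tensor_scale1 tensor_scaleDr tensor_scaleDl.

Lemma tensDl x x' y : tens (x + x') y = tens x y + tens x' y.
Proof. by rewrite [RHS]tensor_addE; apply/tensor_eqP/TensorDl. Qed.

Lemma tensDr x y y' : tens x (y + y') = tens x y + tens x y'.
Proof. by rewrite [RHS]tensor_addE; apply/tensor_eqP/TensorDr. Qed.

Lemma tensZl a x y : tens (a *: x) y = a *: tens x y.
Proof. by rewrite [RHS]tensor_scaleE. Qed.

Lemma tensZr a x y : tens x (a *: y) = a *: tens x y.
Proof. by rewrite -tensZl; apply/tensor_eqP/TensorSym/TensorZ. Qed.

End Tensor.

Section Haagerup.
Variable R : realType.
Notation C := R[i].

Definition haagerup_norm (X Y : lmodType C) (NX : matnorm X) (NY : matnorm Y) :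
    matnorm (tensor X Y) := fun n z =>
  inf [set r : R | exists m (x : 'M[X]_(n, m)) (y : 'M[Y]_(m, n)),
    z = mxprod (@tens _ X Y) x y /\ r = rect_norm NX x * rect_norm NY y].

Definition linear_subspace (V : lmodType C) (S : set V) : Prop :=
  S 0 /\ forall c x y, S x -> S y -> S (c *: x + y).

Definition linear_span (V : lmodType C) (S : set V) : set V :=
  [set v | forall W : set V, linear_subspace W -> S `<=` W -> W v].

(* Completions and quotients are only determined up to a unique completely
   isometric isomorphism, so the Haagerup tensor product and its balanced
   version are given by their defining data. *)
Record haagerup_tensor (X Y : lmodType C) (NX : matnorm X) (NY : matnorm Y) :=
    HaagerupTensor {
  ht_space :> operatorSpace R;
  ht_incl : tensor X Y -> ht_space;
  ht_incl_linear : linear ht_incl;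
  ht_incl_norm : forall n (z : 'M[tensor X Y]_n),
    os_norm ht_space n (map_mx ht_incl z) = haagerup_norm NX NY z;
  ht_incl_dense : norm_closure (norm1 (os_norm ht_space)) (range ht_incl) = setT
}.

Arguments ht_incl {X Y NX NY} h.

(* The closed span of the elements x b (x) y - x (x) b y. *)
Definition balanced_kernel (B : Type) (X Y : lmodType C)
    (NX : matnorm X) (NY : matnorm Y) (ra : X -> B -> X) (la : B -> Y -> Y)
    (T : haagerup_tensor NX NY) : set T :=
  norm_closure (norm1 (os_norm T))
    (linear_span [set k | exists x b y,
       k = ht_incl T (tens (ra x b) y) - ht_incl T (tens x (la b y))]).

Record balanced_haagerup (B : Type) (X Y : lmodType C)
    (NX : matnorm X) (NY : matnorm Y) (ra : X -> B -> X) (la : B -> Y -> Y) :=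
    BalancedHaagerup {
  bh_tensor : haagerup_tensor NX NY;
  bh_space :> operatorSpace R;
  bh_quot : bh_tensor -> bh_space;
  bh_quot_linear : linear bh_quot;
  bh_quot_surj : range bh_quot = setT;
  bh_quot_norm : forall n (z : 'M[bh_tensor]_n),
    os_norm bh_space n (map_mx bh_quot z) =
      inf [set os_norm bh_tensor n (z + w) |
            w in [set w : 'M[bh_tensor]_n |
                    forall i j, balanced_kernel ra la (w i j)]]
}.

Arguments bh_quot {B X Y NX NY ra la} b.

Definition bh_tens B X Y NX NY ra la
    (K : @balanced_haagerup B X Y NX NY ra la) (x : X) (y : Y) : K :=
  bh_quot K (ht_incl (bh_tensor K) (tens x y)).

(* K(X) is the balanced Haagerup tensor product of X with its adjoint module,
   with its operator *-algebra structure. *)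
Record compacts (A B : operatorStarAlgebra R) (X : correspondence A B) :=
    Compacts {
  cpt_space :> balanced_haagerup (os_norm X) (conj_norm (os_norm X))
    (@oc_ract _ _ _ X) (@conj_lact _ _ _ X);
  cpt_mul : cpt_space -> cpt_space -> cpt_space;
  cpt_dag : cpt_space -> cpt_space;
  cpt_axioms : is_operator_star_algebra (os_norm cpt_space) cpt_mul cpt_dag;
  cpt_mul_tens : forall x0 y0 x1 y1,
    cpt_mul (bh_tens cpt_space x0 (Adj y0)) (bh_tens cpt_space x1 (Adj y1)) =
      bh_tens cpt_space (oc_ract x0 (oc_pair y0 x1)) (Adj y1);
  cpt_dag_tens : forall x y,
    cpt_dag (bh_tens cpt_space x (Adj y)) = bh_tens cpt_space y (Adj x)
}.

End Haagerup.

Section Subspace.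
Variables (R : realType) (V : lmodType R[i]) (S : set V).
Hypothesis hS : linear_subspace S.

Definition subspace_pred (_ : linear_subspace S) : {pred V} := [pred x | `[< S x >]].

Fact subspace_closed : subsemimod_closed (subspace_pred hS).
Proof.
have [S0 SD] := hS; split; first split.
- exact/asboolP.
- by move=> x y /asboolP Sx /asboolP Sy; apply/asboolP;
    rewrite -[x]scale1r; exact: SD.
- by move=> c x /asboolP Sx; apply/asboolP; rewrite -[_ *: _]addr0; exact: SD.
Qed.

HB.instance Definition _ :=
  GRing.isSubSemiModClosed.Build R[i] V (subspace_pred hS) subspace_closed.

Record subspace := Subspace { subspace_val : V; _ : subspace_val \in subspace_pred hS }.

HB.instance Definition _ := [isSub for subspace_val].
HB.instance Definition _ := [Choice of subspace by <:].
HB.instance Definition _ := [SubChoice_isSubLmodule of subspace by <:].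

Definition sub_norm (N : matnorm V) : matnorm subspace :=
  fun n x => N n (map_mx subspace_val x).

End Subspace.

Section Linking.
Variables (R : realType) (A B : operatorStarAlgebra R) (X : correspondence A B).
Variables (pi : standard_rep X) (K : compacts X).

Definition sr_Xdag (y : conj_mod X) : BL (sr_H pi) :=
  bl_comp (sr_U pi) (bl_comp (adjoint (sr_X pi (unadj y))) (sr_U pi)).

Record is_compacts_rep (piK : K -> BL (sr_H pi)) : Prop := {
  cr_linear : linear piK;
  cr_bounded : completely_bounded (os_norm K) (bl_mxnorm (sr_H pi)) piK;
  cr_mul : forall k k', piK (cpt_mul k k') = bl_comp (piK k) (piK k');
  cr_tens : forall x y, piK (bh_tens K x y) = bl_comp (sr_X pi x) (sr_Xdag y)
}.

Definition linking_op (piK : K -> BL (sr_H pi)) (a : A) (b : B) (x y : X) (k : K) :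
    BL (dsum (sr_H pi)) :=
  block_op (sr_B pi b) (sr_Xdag (Adj y)) (sr_X pi x) (sr_A pi a + piK k).

Definition linking_algebra (piK : K -> BL (sr_H pi)) :
    set (BL (dsum (sr_H pi))) :=
  norm_closure (norm1 (bl_mxnorm (dsum (sr_H pi))))
    [set T | exists a b x y k, T = linking_op piK a b x y k].

Definition linking_U : BL (dsum (sr_H pi)) := block_op (sr_U pi) 0 0 (sr_U pi).

End Linking.

(* Main.v *)
From HB Require Import structures.
Require Import Defs.
From mathcomp Require Import all_boot all_order all_algebra.
From mathcomp Require Import sesquilinear complex ring lra.
From mathcomp Require Import all_classical all_reals.
Set Implicit Arguments.
Unset Strict Implicit.
Unset Printing Implicit Defensive.
Import Order.TTheory GRing.Theory Num.Theory.
Local Open Scope ring_scope.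
Local Open Scope classical_set_scope.

(* Writing star T := U T^* U, the linking algebra is the norm closure of the
   2 x 2 operator matrices whose lower right corner lies in pi(A) plus the span
   of the pi(x) star(pi(y)).  By the axioms of a standard form representation
   this set is a subalgebra invariant under star, with no closure needed in
   any of the corners.  Multiplication is continuous and star is a complete
   isometry, so both pass to the closure; and a closed star-invariant
   subalgebra of B(H) inherits its operator space structure from B(H).  For
   B(H) itself the axioms rest on the existence of adjoints (Riesz) and, for
   scalar matrices acting on H^n, on factoring Gram matrices. *)

(** The delicate corner is the lower right one. [K] is a completed quotient, so a product of [piK k]
    with some [sr_X pi w] is a priori only a limit of operators of the form [sr_X pi x]. For finite
    sums of elementary tensors the product is explicit: pi(x) star(pi(y)) pi(w) = pi(x) pi(<y, w>) =
    pi(x <y, w>), by the pairing and right module axioms. Density of the algebraic tensors in [K]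
    and boundedness of [piK] then show that both choices of corner have the same closure. The Gram
    factorization answers another mismatch: a scalar matrix has its norm measured on columns of
    complex numbers, but acts on columns of vectors of [H]. A factor of the Gram matrix supplies
    complex coordinates for these vectors without choosing an orthonormal basis. *)

Section ComplexModulus.
Variable R : realType.

Lemma normcCE (z : R[i]) : `|z| = (Normc.normc z)%:C%C. Proof. by []. Qed.

Lemma normc_ge0 (z : R[i]) : 0 <= Normc.normc z.
Proof. by rewrite -lecR -normcCE normr_ge0. Qed.

Lemma Re_le_normc (z : R[i]) : complex.Re z <= Normc.normc z.
Proof. by rewrite -lecR -normcCE (le_trans _ (normc_ge_Re z))// lecR ler_norm. Qed.

Lemma normc_real (c : R) : 0 <= c -> Normc.normc c%:C%C = c.
Proof. by move=> c0; apply: complexI; rewrite -normcCE ger0_norm// ler0c. Qed.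

Lemma Re_conjC (z : R[i]) : complex.Re z^* = complex.Re z.
Proof. by case: z. Qed.

End ComplexModulus.

(** * Norm of a dot product, Cauchy-Schwarz and triangle inequality *)

Section DotForms.
Variables (R : realType) (V : lmodType R[i]) (f : {dot V for Num.conj}).
Notation hn := (hnorm f).

Lemma dot_Re_ge0 x : 0 <= complex.Re (f x x).
Proof. by have := dnorm_ge0 f x; rewrite lecE => /andP[]. Qed.

Lemma hnorm_ge0 x : 0 <= hn x. Proof. exact: sqrtr_ge0. Qed.

Lemma hnorm_sqr x : hn x ^+ 2 = complex.Re (f x x).
Proof. by rewrite sqr_sqrtr// dot_Re_ge0. Qed.

Lemma dot_hnorm x : f x x = (hn x ^+ 2)%:C%C.
Proof.
rewrite hnorm_sqr; have := dnorm_ge0 f x; rewrite lecE => /andP[/eqP/= + _].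
by case: (f x x) => a b /= ->.
Qed.

Lemma hnorm_eq0 x : hn x = 0 -> x = 0.
Proof.
by move=> x0; apply/eqP; rewrite -(dnorm_eq0 f) dot_hnorm x0 expr0n.
Qed.

Lemma hnormZ a x : hn (a *: x) = Normc.normc a * hn x.
Proof.
apply/(@pexpIrn _ 2) => //; rewrite ?nnegrE ?mulr_ge0 ?hnorm_ge0 ?normc_ge0//.
apply: complexI; rewrite -dot_hnorm dnormZ exprMn dot_hnorm normcCE.
by rewrite -rmorphXn -rmorphM.
Qed.

Lemma hnorm0 : hn 0 = 0.
Proof. by rewrite -(scale0r 0) hnormZ Normc.normc0 mul0r. Qed.

Lemma hnormN x : hn (- x) = hn x.
Proof. by rewrite -scaleN1r hnormZ normcN Normc.normc1 mul1r. Qed.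

Lemma hnormBC x y : hn (x - y) = hn (y - x).
Proof. by rewrite -hnormN opprB. Qed.

Lemma hnorm_dotC x y : f x y = (f y x)^*.
Proof. by rewrite (hermC f x y) expr0 mul1r. Qed.

Lemma dot_le_hnorm x y : Normc.normc (f x y) <= hn x * hn y.
Proof.
have [->|y0] := eqVneq y 0.
  by rewrite linear0r Normc.normc0 hnorm0 mulr0.
have n0 : 0 < f y y by rewrite dnorm_gt0.
rewrite -(@ler_pXn2r _ 2)// ?nnegrE ?mulr_ge0 ?hnorm_ge0 ?normc_ge0//.
have -> : Normc.normc (f x y) ^+ 2 <= (hn x * hn y) ^+ 2 = (`|f x y| ^+ 2 <= f x x * f y y).
  by rewrite !dot_hnorm normcCE -rmorphXn -rmorphM lecR exprMn.
set c := f x y; set n := f y y in n0 *.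
have := dnorm_ge0 f (n *: x - c *: y).
rewrite dnormB !dnormZ /= linearZl_LR linearZr_LR /= -/n -/c.
rewrite (ger0_norm (ltW n0)) normCK.
have -> : (n * (c^* * c))^* = n * (c * c^*).
  by rewrite !(rmorphM Num.conj) /= conjCK (conj_Creal (ger0_real (ltW n0))).
rewrite [c^* * c]mulrC [c * c^* * n]mulrC opprD addrA addrK -mulrA -mulrBr.
rewrite [n * f x x]mulrC.
by rewrite pmulr_rge0// subr_ge0.
Qed.

Lemma hnormDsqr x y : hn (x + y) ^+ 2 =
  hn x ^+ 2 + hn y ^+ 2 + 2 * complex.Re (f x y).
Proof.
by rewrite !hnorm_sqr dnormD !raddfD /= Re_conjC -mulr2n mulr_natl.
Qed.

Lemma hnormD x y : hn (x + y) <= hn x + hn y.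
Proof.
rewrite -(@ler_pXn2r _ 2)// ?nnegrE ?addr_ge0 ?hnorm_ge0//.
rewrite hnormDsqr sqrrD.
have := le_trans (Re_le_normc _) (dot_le_hnorm x y); nra.
Qed.

Lemma hnorm_triangle z x y : hn (x - y) <= hn (x - z) + hn (z - y).
Proof. by apply: le_trans (hnormD _ _); rewrite addrA subrK. Qed.

Lemma hnorm_sum I (r : seq I) (F : I -> V) :
  hn (\sum_(i <- r) F i) <= \sum_(i <- r) hn (F i).
Proof.
elim/big_ind2: _ => [|a b c d ab cd|//]; first by rewrite hnorm0.
exact: le_trans (hnormD _ _) (lerD _ _).
Qed.

Lemma dot_inj x y : (forall z, f z x = f z y) -> x = y.
Proof.
move=> xy; apply/eqP; rewrite -subr_eq0 -(dnorm_eq0 f) linearBr /=.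
by rewrite xy subrr.
Qed.

End DotForms.

(** * Operator norms as suprema over a unit ball, for scalar and operator matrices alike *)

Section OperatorSup.
Variables (R : realType) (V W : Type) (N1 : V -> R) (N2 : W -> R).
Variables (scV : R[i] -> V -> V) (scW : R[i] -> W -> W) (x0 : V).
Variable f : V -> W.
Hypothesis N1Z : forall c x, N1 (scV c x) = Normc.normc c * N1 x.
Hypothesis N2Z : forall c x, N2 (scW c x) = Normc.normc c * N2 x.
Hypothesis N1_ge0 : forall x, 0 <= N1 x.
Hypothesis fZ : forall c x, f (scV c x) = scW c (f x).

Let S := [set N2 (f v) | v in [set v | N1 v <= 1]].

Let S0 : S 0.
Proof.
exists (scV 0 x0) => /=; first by rewrite N1Z Normc.normc0 mul0r.
by rewrite fZ N2Z Normc.normc0 mul0r.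
Qed.

Lemma op_sup_le c : 0 <= c -> (forall v, N2 (f v) <= c * N1 v) -> sup S <= c.
Proof.
move=> c0 fc; apply: ge_sup; first by exists 0; exact: S0.
move=> _ [v /= v1 <-]; apply: le_trans (fc v) _.
by rewrite -[leRHS]mulr1 ler_wpM2l.
Qed.

Hypothesis f_bounded : exists c, forall v, N2 (f v) <= c * N1 v.

Let S_ub : has_ubound S.
Proof.
have [c fc] := f_bounded; exists (Num.max c 0) => _ [v /= v1 <-].
apply: le_trans (fc v) _; apply: (@le_trans _ _ (Num.max c 0 * N1 v)).
  by rewrite ler_wpM2r// le_max lexx.
by rewrite -[leRHS]mulr1 ler_wpM2l// le_max lexx orbT.
Qed.

Lemma op_sup_ge0 : 0 <= sup S.
Proof. by apply: ub_le_sup => //; exact: S0. Qed.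

Lemma op_sup_bound v : N2 (f v) <= sup S * N1 v.
Proof.
have := N1_ge0 v; rewrite le_eqVlt => /predU1P[v0|v0].
  (* Such a [v] cannot be normalised, but boundedness already forces [N2 (f v) <= 0]. *)
  by have [c /(_ v)] := f_bounded; rewrite -v0 !mulr0.
have nv : Normc.normc ((N1 v)^-1)%:C%C = (N1 v)^-1.
  by rewrite normc_real// invr_ge0 ltW.
rewrite -ler_pdivrMr// mulrC -[X in X * _]nv -N2Z -fZ.
apply: ub_le_sup => //; exists (scV ((N1 v)^-1)%:C%C v) => //=.
by rewrite N1Z nv mulVf// gt_eqF.
Qed.

End OperatorSup.

(** * Norms of columns of numbers and of vectors *)

Section ColumnNorm.
Variable R : realType.

Definition l2norm n (r : 'I_n -> R) : R := Num.sqrt (\sum_i r i ^+ 2).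

Lemma l2norm_ge0 n (r : 'I_n -> R) : 0 <= l2norm r.
Proof. exact: sqrtr_ge0. Qed.

Lemma l2norm_sqr n (r : 'I_n -> R) : l2norm r ^+ 2 = \sum_i r i ^+ 2.
Proof. by rewrite sqr_sqrtr// sumr_ge0// => i _; exact: sqr_ge0. Qed.

Lemma l2normZ n c (r : 'I_n -> R) : 0 <= c -> l2norm (fun i => c * r i) = c * l2norm r.
Proof.
move=> c0; rewrite /l2norm; under eq_bigr do rewrite exprMn.
by rewrite -mulr_sumr sqrtrM ?sqr_ge0// sqrtr_sqr ger0_norm.
Qed.

Lemma l2norm_comp n (r : 'I_n -> R) i : 0 <= r i -> r i <= l2norm r.
Proof.
move=> ri0; rewrite -(@ler_pXn2r _ 2)// ?nnegrE ?l2norm_ge0// l2norm_sqr.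
by rewrite (bigD1 i)//= lerDl sumr_ge0// => j _; exact: sqr_ge0.
Qed.

Lemma l2norm_le_sum n (r : 'I_n -> R) : (forall i, 0 <= r i) ->
  l2norm r <= \sum_i r i.
Proof.
move=> r0; rewrite -(@ler_pXn2r _ 2)// ?nnegrE ?l2norm_ge0 ?sumr_ge0//.
rewrite l2norm_sqr expr2 mulr_suml ler_sum// => i _.
by rewrite expr2 ler_wpM2l// (bigD1 i)//= lerDl sumr_ge0.
Qed.

(** The constant is deliberately crude: it serves only to show that the suprema defining the matrix
    norms are finite. *)
Lemma l2norm_bounded m n (c : 'I_m -> 'I_n -> R) :
  (forall i k, 0 <= c i k) -> forall (r : 'I_n -> R) (s : 'I_m -> R),
  (forall k, 0 <= r k) -> (forall i, 0 <= s i) ->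
  (forall i, s i <= \sum_k c i k * r k) ->
  l2norm s <= (\sum_i \sum_k c i k) * l2norm r.
Proof.
move=> c0 r s r0 s0 sr; apply: le_trans (l2norm_le_sum s0) _.
rewrite mulr_suml ler_sum// => i _; apply: le_trans (sr i) _.
by rewrite mulr_suml ler_sum// => k _; rewrite ler_wpM2l// l2norm_comp.
Qed.

End ColumnNorm.

Section ColumnDot.
Variables (R : realType) (V : lmodType R[i]) (f : {dot V for Num.conj}) (n : nat).

(** Finite functions form a module, so Cauchy-Schwarz and the triangle inequality for general dot
    products apply to them and reach columns through [colfun]. *)
Definition col_ip (v w : {ffun 'I_n -> V}) : R[i] := \sum_i f (v i) (w i).

Fact col_ip_bilinear :
  bilinear_for *%R (Num.conj \; *%R) col_ip.
Proof.
split=> w a u v; rewrite /col_ip /= mulr_sumr -big_split /=; apply: eq_bigr => i _.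
  by rewrite !ffunE linearDl/= linearZl_LR.
by rewrite !ffunE raddfD/= linearZr_LR.
Qed.

HB.instance Definition _ :=
  bilinear_isBilinear.Build R[i] {ffun 'I_n -> V} {ffun 'I_n -> V} R[i] *%R (Num.conj \; *%R)
    col_ip col_ip_bilinear.

Fact col_ip_herm (v w : {ffun 'I_n -> V}) : col_ip v w = (-1) ^+ false * Num.conj (col_ip w v).
Proof.
rewrite expr0 mul1r /col_ip rmorph_sum; apply: eq_bigr => i _.
exact: hnorm_dotC.
Qed.

HB.instance Definition _ := isHermitianSesquilinear.Build R[i] {ffun 'I_n -> V} false Num.conj
  col_ip col_ip_herm.

Fact col_ip_gt0 (v : {ffun 'I_n -> V}) : v != 0 -> 0 < col_ip v v.
Proof.
move=> v0; rewrite lt_neqAle eq_sym sumr_ge0 ?andbT//.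
apply: contra v0; rewrite psumr_eq0 ?dnorm_ge0//.
move=> /allP vi; apply/eqP/ffunP => i; rewrite ffunE; apply/eqP.
by have /= := vi i (mem_index_enum i); rewrite (dnorm_eq0 f).
Qed.

HB.instance Definition _ := isDotProduct.Build R[i] {ffun 'I_n -> V} col_ip col_ip_gt0.

Definition col_dot : {dot ({ffun 'I_n -> V})%type for Num.conj} := col_ip.

End ColumnDot.

Section ColumnNorms.
Variables (R : realType) (H : hilbert R).
Notation C := R[i].
Notation hn := (hnorm (hs_ip H)).

Definition colfun n (v : 'cV[H]_n) : {ffun 'I_n -> H} := [ffun i => v i 0].

Definition vec_ip n (v w : 'cV[H]_n) : C := col_dot (hs_ip H) n (colfun v) (colfun w).

Lemma vec_ipE n (v w : 'cV[H]_n) : vec_ip v w = \sum_i hs_ip H (v i 0) (w i 0).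
Proof. by apply: eq_bigr => i _; rewrite !ffunE. Qed.

Lemma vec_norm_l2 n (v : 'cV[H]_n) : vec_norm v = l2norm (fun i => hn (v i 0)).
Proof. by []. Qed.

Lemma vec_norm_hnorm n (v : 'cV[H]_n) :
  vec_norm v = hnorm (col_dot (hs_ip H) n) (colfun v).
Proof.
rewrite /hnorm -[_ (colfun v) _]/(vec_ip v v) vec_ipE raddf_sum.
by congr Num.sqrt; apply: eq_bigr => i _; rewrite hnorm_sqr.
Qed.

Lemma vec_norm_ge0 n (v : 'cV[H]_n) : 0 <= vec_norm v.
Proof. exact: sqrtr_ge0. Qed.

Lemma vec_norm_sqr n (v : 'cV[H]_n) : vec_norm v ^+ 2 = complex.Re (vec_ip v v).
Proof. by rewrite vec_norm_hnorm hnorm_sqr. Qed.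

Lemma vec_normZ n c (v : 'cV[H]_n) :
  vec_norm (map_mx ( *:%R c) v) = Normc.normc c * vec_norm v.
Proof.
rewrite !vec_norm_hnorm -hnormZ; congr (hnorm _ _).
by apply/ffunP => i; rewrite !ffunE mxE.
Qed.

Lemma vec_normD n (v w : 'cV[H]_n) : vec_norm (v + w) <= vec_norm v + vec_norm w.
Proof.
rewrite !vec_norm_hnorm; apply: le_trans (hnormD _ _ _).
by rewrite le_eqVlt; apply/orP; left; apply/eqP; congr (hnorm _ _);
  apply/ffunP => i; rewrite !ffunE mxE.
Qed.

Lemma vec_ip_le n (v w : 'cV[H]_n) : Normc.normc (vec_ip v w) <= vec_norm v * vec_norm w.
Proof. by rewrite !vec_norm_hnorm; exact: dot_le_hnorm. Qed.

Lemma vec_norm1 (x : H) : vec_norm (const_mx x : 'cV[H]_1) = hn x.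
Proof. by rewrite /vec_norm big_ord1 mxE sqrtr_sqr ger0_norm// hnorm_ge0. Qed.

Lemma vec_norm_eq0 n (v : 'cV[H]_n) : vec_norm v = 0 -> v = 0.
Proof.
rewrite vec_norm_hnorm => /hnorm_eq0 v0; apply/colP => i.
by have /ffunP/(_ i) := v0; rewrite !ffunE mxE.
Qed.

Lemma vec_norm_col_mx m n (v : 'cV[H]_m) (w : 'cV[H]_n) :
  vec_norm (col_mx v w) ^+ 2 = vec_norm v ^+ 2 + vec_norm w ^+ 2.
Proof.
rewrite !vec_norm_l2 !l2norm_sqr big_split_ord /=.
by congr (_ + _); apply: eq_bigr => i _; rewrite ?col_mxEu ?col_mxEd.
Qed.

End ColumnNorms.

(** * The operator norm of scalar matrices *)

Section ScalarNorm.
Variable R : realType.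
Notation C := R[i].

Lemma normc_sum I (r : seq I) (F : I -> C) :
  Normc.normc (\sum_(i <- r) F i) <= \sum_(i <- r) Normc.normc (F i).
Proof.
elim/big_ind2: _ => [|a b c d ab cd|//]; first by rewrite Normc.normc0.
exact: le_trans (le_normcD _ _) (lerD _ _).
Qed.

Lemma cvec_normZ n c (v : 'cV[C]_n) : cvec_norm (c *: v) = Normc.normc c * cvec_norm v.
Proof.
rewrite -[RHS]l2normZ ?normc_ge0//; congr Num.sqrt; apply: eq_bigr => i _.
by rewrite mxE Normc.normcM.
Qed.

Lemma cvec_norm_ge0 n (v : 'cV[C]_n) : 0 <= cvec_norm v.
Proof. exact: sqrtr_ge0. Qed.

Lemma cvec_mul_bounded m n (a : 'M[C]_(m, n)) :
  exists c, forall v : 'cV[C]_n, cvec_norm (a *m v) <= c * cvec_norm v.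
Proof.
exists (\sum_i \sum_k Normc.normc (a i k)) => v.
apply: l2norm_bounded => [i k|k|i|i]; rewrite ?normc_ge0//.
rewrite mxE; apply: le_trans (normc_sum _ _) _.
by apply: ler_sum => k _; rewrite Normc.normcM.
Qed.

Lemma scalar_mxnorm_bound m n (a : 'M[C]_(m, n)) v :
  cvec_norm (a *m v) <= scalar_mxnorm a * cvec_norm v.
Proof.
apply: (op_sup_bound (N1 := @cvec_norm R n) (N2 := @cvec_norm R m) (f := mulmx a)
  (scV := *:%R) (scW := *:%R)) => //.
- exact: cvec_normZ.
- exact: cvec_normZ.
- exact: cvec_norm_ge0.
- by move=> c x; rewrite scalemxAr.
- exact: cvec_mul_bounded.
Qed.

Lemma scalar_mxnorm_ge0 m n (a : 'M[C]_(m, n)) : 0 <= scalar_mxnorm a.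
Proof.
apply: (op_sup_ge0 (N1 := @cvec_norm R n) (N2 := @cvec_norm R m) (f := mulmx a)
  (scV := *:%R) (scW := *:%R) 0) => //.
- exact: cvec_normZ.
- exact: cvec_normZ.
- exact: cvec_norm_ge0.
- by move=> c x; rewrite scalemxAr.
- exact: cvec_mul_bounded.
Qed.

End ScalarNorm.

(** * Matrix products along general pairings *)

Section MxProd.

(** Four different pairings are allowed so that one exchange of sums covers both composition of
    operator matrices and scalar matrices moved past an operator matrix. *)
Lemma mxprodA (U V W X Z : nmodType) (T : Type) (f : X -> T -> Z) (g : U -> V -> X)
    (h : U -> W -> Z) (k : V -> T -> W) m n p q
    (x : 'M[U]_(m, n)) (y : 'M[V]_(n, p)) (z : 'M[T]_(p, q)) :
  (forall a b c, f (g a b) c = h a (k b c)) ->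
  (forall c, {morph f^~ c : a b / a + b}) -> (forall c, f 0 c = 0) ->
  (forall a, {morph h a : b c / b + c}) -> (forall a, h a 0 = 0) ->
  mxprod f (mxprod g x y) z = mxprod h x (mxprod k y z).
Proof.
move=> fg fD f0 hD h0; apply/matrixP => i j; rewrite !mxE.
under eq_bigr do rewrite mxE (big_morph _ (fD _) (f0 _)).
rewrite exchange_big /=; apply: eq_bigr => l _.
by rewrite mxE (big_morph _ (hD _) (h0 _)); apply: eq_bigr => r _; rewrite fg.
Qed.

Lemma mxprodDl (U Z : nmodType) (V : Type) (f : U -> V -> Z) m n p
    (x y : 'M[U]_(m, n)) (z : 'M[V]_(n, p)) :
  (forall c, {morph f^~ c : a b / a + b}) ->
  mxprod f (x + y) z = mxprod f x z + mxprod f y z.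
Proof.
by move=> fD; apply/matrixP => i j; rewrite !mxE -big_split /=;
  apply: eq_bigr => k _; rewrite mxE fD.
Qed.

Lemma mxprod_map (U U' V V' Z Z' : nmodType) (f : U -> V -> Z) (g : U' -> V' -> Z')
    (al : U -> U') (be : V -> V') (ga : Z -> Z') m n p
    (x : 'M[U]_(m, n)) (y : 'M[V]_(n, p)) :
  (forall a b, g (al a) (be b) = ga (f a b)) ->
  {morph ga : a b / a + b} -> ga 0 = 0 ->
  mxprod g (map_mx al x) (map_mx be y) = map_mx ga (mxprod f x y).
Proof.
move=> gf gD g0; apply/matrixP => i j; rewrite !mxE (big_morph _ gD g0).
by apply: eq_bigr => k _; rewrite !mxE.
Qed.

End MxProd.

(** * Matrix norms of bounded operators *)

Section BoundedOperatorTheory.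
Variables (R : realType) (H : hilbert R).
Notation C := R[i].
Notation ip := (hs_ip H).
Notation hn := (hnorm ip).
Implicit Types S T : BL H.

HB.instance Definition _ T := GRing.isLinear.Build C H H *:%R T (bl_linear T).

Lemma bl_ext S T : (forall x, S x = T x) -> S = T.
Proof. by move=> ST; apply: val_inj; apply/funext. Qed.

Lemma bl_addE S T x : (S + T) x = S x + T x. Proof. by []. Qed.
Lemma bl_scaleE c T x : (c *: T) x = c *: T x. Proof. by []. Qed.

Lemma bl_hnorm_bound T : exists2 c, 0 <= c & forall x, hn (T x) <= c * hn x.
Proof.
have /asboolP[_ [c Tc]] := bl_funP T; exists (Num.max c 0).
  by rewrite le_max lexx orbT.
by move=> x; apply: le_trans (Tc x) _; rewrite ler_wpM2r ?hnorm_ge0// le_max lexx.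
Qed.

Lemma bl_compDl T : {morph (bl_comp (H := H))^~ T : S S' / S + S'}.
Proof. by move=> S S'; apply: bl_ext. Qed.

Lemma bl_compDr S : {morph bl_comp S : T T' / T + T'}.
Proof. by move=> T T'; apply: bl_ext => x /=; rewrite linearD. Qed.

Lemma bl_comp0l T : bl_comp 0 T = 0. Proof. exact: bl_ext. Qed.

Lemma bl_comp0r S : bl_comp S 0 = 0.
Proof. by apply: bl_ext => x /=; rewrite linear0. Qed.

Lemma bl_compZl c S T : bl_comp (c *: S) T = c *: bl_comp S T.
Proof. exact: bl_ext. Qed.

Lemma bl_compZr c S T : bl_comp S (c *: T) = c *: bl_comp S T.
Proof. by apply: bl_ext => x /=; rewrite linearZ. Qed.

Lemma bl_compA : associative (@bl_comp R H).
Proof. by move=> S T U; apply: bl_ext. Qed.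

Lemma bl_comp1l T : bl_comp (bl_id H) T = T. Proof. exact: bl_ext. Qed.
Lemma bl_comp1r T : bl_comp T (bl_id H) = T. Proof. exact: bl_ext. Qed.

Definition mxop m n (T : 'M[BL H]_(m, n)) (v : 'cV[H]_n) : 'cV[H]_m :=
  mxprod (fun (S : BL H) x => S x) T v.

Lemma mxopE m n (T : 'M[BL H]_(m, n)) v i : mxop T v i 0 = \sum_k T i k (v k 0).
Proof. by rewrite mxE. Qed.

Lemma mxop1 T x : mxop (const_mx T : 'M_1) (const_mx x) = const_mx (T x).
Proof. by apply/colP => i; rewrite mxopE big_ord1 !mxE. Qed.

Lemma mxopZ m n (T : 'M[BL H]_(m, n)) c v :
  mxop T (map_mx ( *:%R c) v) = map_mx ( *:%R c) (mxop T v).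
Proof.
apply/colP => i; rewrite [RHS]mxE !mxopE scaler_sumr; apply: eq_bigr => k _.
by rewrite mxE linearZ.
Qed.

Lemma mxop_bounded n (T : 'M[BL H]_n) :
  exists c, forall v, vec_norm (mxop T v) <= c * vec_norm v.
Proof.
have /choice[c Tc] (p : 'I_n * 'I_n) :
    exists c, 0 <= c /\ forall x, hn (T p.1 p.2 x) <= c * hn x.
  by have [c c0 Tc] := bl_hnorm_bound (T p.1 p.2); exists c.
exists (\sum_i \sum_k c (i, k)) => v; rewrite !vec_norm_l2.
apply: l2norm_bounded => [i k|k|i|i]; rewrite ?hnorm_ge0//; first by case: (Tc (i, k)).
rewrite mxopE; apply: le_trans (hnorm_sum _ _ _) _; apply: ler_sum => k _.
by case: (Tc (i, k)) => _; exact.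
Qed.

Lemma bl_mxnorm_bound n (T : 'M[BL H]_n) v :
  vec_norm (mxop T v) <= bl_mxnorm H n T * vec_norm v.
Proof.
apply: (op_sup_bound (N1 := @vec_norm R H n) (N2 := @vec_norm R H n) (f := mxop T)
  (scV := fun c => map_mx ( *:%R c)) (scW := fun c => map_mx ( *:%R c))) => //.
- exact: vec_normZ.
- exact: vec_normZ.
- exact: vec_norm_ge0.
- by move=> c x; exact: mxopZ.
- exact: mxop_bounded.
Qed.

Lemma bl_mxnorm_ge0 n (T : 'M[BL H]_n) : 0 <= bl_mxnorm H n T.
Proof.
apply: (op_sup_ge0 (N1 := @vec_norm R H n) (N2 := @vec_norm R H n) (f := mxop T)
  (scV := fun c => map_mx ( *:%R c)) (scW := fun c => map_mx ( *:%R c)) 0) => //.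
- exact: vec_normZ.
- exact: vec_normZ.
- exact: vec_norm_ge0.
- by move=> c x; exact: mxopZ.
- exact: mxop_bounded.
Qed.

Lemma bl_mxnorm_le n (T : 'M[BL H]_n) c : 0 <= c ->
  (forall v, vec_norm (mxop T v) <= c * vec_norm v) -> bl_mxnorm H n T <= c.
Proof.
apply: (op_sup_le (N1 := @vec_norm R H n) (N2 := @vec_norm R H n) (f := mxop T)
  (scV := fun c => map_mx ( *:%R c)) (scW := fun c => map_mx ( *:%R c)) 0) => //.
- exact: vec_normZ.
- exact: vec_normZ.
- by move=> d x; exact: mxopZ.
Qed.

Notation opn := (norm1 (bl_mxnorm H)).

Lemma opnorm_bound T x : hn (T x) <= opn T * hn x.
Proof. by rewrite -!vec_norm1 -mxop1 bl_mxnorm_bound. Qed.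

Lemma opnorm_le T c : 0 <= c -> (forall x, hn (T x) <= c * hn x) -> opn T <= c.
Proof.
move=> c0 Tc; apply: bl_mxnorm_le => // v.
have -> : v = const_mx (v 0 0) by apply/colP => i; rewrite mxE !ord1.
by rewrite mxop1 !vec_norm1.
Qed.

Lemma opnorm_ge0 T : 0 <= opn T. Proof. exact: bl_mxnorm_ge0. Qed.

Lemma mxop_comp m n p (S : 'M[BL H]_(m, n)) (T : 'M[BL H]_(n, p)) v :
  mxop (mxprod (@bl_comp R H) S T) v = mxop S (mxop T v).
Proof. by apply: mxprodA => // [a b c|a]; [exact: linearD|exact: linear0]. Qed.

Lemma bl_mxnorm_comp n (S T : 'M[BL H]_n) :
  bl_mxnorm H n (mxprod (@bl_comp R H) S T) <= bl_mxnorm H n S * bl_mxnorm H n T.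
Proof.
apply: bl_mxnorm_le => [|v]; first by rewrite mulr_ge0 ?bl_mxnorm_ge0.
rewrite mxop_comp; apply: le_trans (bl_mxnorm_bound _ _) _.
by rewrite -mulrA ler_wpM2l ?bl_mxnorm_ge0 ?bl_mxnorm_bound.
Qed.

Lemma bl_mxnormD n (S T : 'M[BL H]_n) :
  bl_mxnorm H n (S + T) <= bl_mxnorm H n S + bl_mxnorm H n T.
Proof.
apply: bl_mxnorm_le => [|v]; first by rewrite addr_ge0 ?bl_mxnorm_ge0.
rewrite /mxop mxprodDl//; apply: le_trans (vec_normD _ _) _.
by rewrite mulrDl lerD ?bl_mxnorm_bound.
Qed.

Lemma mxop_delta n (T : 'M[BL H]_n) j x i :
  mxop T (\col_k (if k == j then x else 0)) i 0 = T i j x.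
Proof.
rewrite mxopE (bigD1 j)//= mxE eqxx big1 ?addr0// => k /negPf kj.
by rewrite mxE kj linear0.
Qed.

Lemma bl_mxnorm_eq0 n (T : 'M[BL H]_n) : bl_mxnorm H n T = 0 -> T = 0.
Proof.
move=> T0; apply/matrixP => i j; apply: bl_ext => x.
rewrite [in RHS]mxE -mxop_delta; set v := \col_k _.
suff -> : mxop T v = 0 by rewrite mxE.
apply: vec_norm_eq0; apply/eqP; rewrite eq_le vec_norm_ge0 andbT.
by apply: le_trans (bl_mxnorm_bound _ _) _; rewrite T0 mul0r.
Qed.

Lemma vec_norm0 n : vec_norm (0 : 'cV[H]_n) = 0.
Proof. by rewrite vec_norm_l2 /l2norm big1 ?sqrtr0// => i _; rewrite mxE hnorm0 expr0n. Qed.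

Lemma mxop_scale n (T : 'M[BL H]_n) c v :
  mxop (map_mx ( *:%R c) T) v = map_mx ( *:%R c) (mxop T v).
Proof.
apply/colP => i; rewrite [RHS]mxE !mxopE scaler_sumr.
by apply: eq_bigr => k _; rewrite mxE.
Qed.

Lemma bl_mxnormZ n c (T : 'M[BL H]_n) :
  bl_mxnorm H n (map_mx ( *:%R c) T) = Normc.normc c * bl_mxnorm H n T.
Proof.
have le d (S : 'M[BL H]_n) :
    bl_mxnorm H n (map_mx ( *:%R d) S) <= Normc.normc d * bl_mxnorm H n S.
  apply: bl_mxnorm_le => [|v]; first by rewrite mulr_ge0 ?normc_ge0 ?bl_mxnorm_ge0.
  by rewrite mxop_scale vec_normZ -mulrA ler_wpM2l ?normc_ge0 ?bl_mxnorm_bound.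
apply/eqP; rewrite eq_le le /=; have [->|c0] := eqVneq c 0.
  by rewrite Normc.normc0 mul0r bl_mxnorm_ge0.
have nc : 0 < Normc.normc c.
  by rewrite lt_neqAle normc_ge0 andbT eq_sym; apply: contra c0 => /eqP/Normc.eq0_normc->.
(* The reverse inequality is [le] for the inverse scalar applied to the scaled matrix. *)
have := le c^-1 (map_mx ( *:%R c) T); rewrite Normc.normcV mulrC ler_pdivlMr// mulrC.
congr (_ * bl_mxnorm H n _ <= _); apply/matrixP => i j.
by rewrite !mxE scalerA mulVf// scale1r.
Qed.

Lemma mxop_block m n (S : 'M[BL H]_m) (T : 'M[BL H]_n) v w :
  mxop (block_mx S 0 0 T) (col_mx v w) = col_mx (mxop S v) (mxop T w).
Proof.
apply/colP => i; case: (split_ordP i) => j ->; rewrite ?col_mxEu ?col_mxEd !mxopE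
  big_split_ord /=.
  rewrite [X in _ + X]big1 ?addr0; last by move=> k _; rewrite block_mxEur mxE.
  by apply: eq_bigr => k _; rewrite block_mxEul col_mxEu.
rewrite [X in X + _]big1 ?add0r; last by move=> k _; rewrite block_mxEdl mxE.
by apply: eq_bigr => k _; rewrite block_mxEdr col_mxEd.
Qed.

Lemma bl_mxnorm_block m n (S : 'M[BL H]_m) (T : 'M[BL H]_n) :
  bl_mxnorm H (m + n)%N (block_mx S 0 0 T) = Num.max (bl_mxnorm H m S) (bl_mxnorm H n T).
Proof.
have S0 := bl_mxnorm_ge0 S; have T0 := bl_mxnorm_ge0 T.
set c := Num.max _ _; have c0 : 0 <= c by rewrite le_max S0.
apply/eqP; rewrite eq_le; apply/andP; split.
  apply: bl_mxnorm_le => // v; rewrite -[v]vsubmxK mxop_block.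
  rewrite -(@ler_pXn2r _ 2)// ?nnegrE ?mulr_ge0 ?vec_norm_ge0//.
  rewrite exprMn !vec_norm_col_mx mulrDr -!exprMn.
  apply: lerD; rewrite ler_pXn2r ?nnegrE ?mulr_ge0 ?vec_norm_ge0//;
    apply: le_trans (bl_mxnorm_bound _ _) _; rewrite ler_wpM2r ?vec_norm_ge0//;
    by rewrite le_max lexx ?orbT.
(* Padding a column with zeros is isometric, so each diagonal block is a restriction of the block
   matrix; this gives the reverse inequality. *)
have col0 p q (v : 'cV[H]_p) : vec_norm (col_mx v (0 : 'cV_q)) = vec_norm v.
  by apply/(@pexpIrn _ 2) => //; rewrite ?nnegrE ?vec_norm_ge0//
    vec_norm_col_mx vec_norm0 expr0n addr0.
have col0' p q (v : 'cV[H]_p) : vec_norm (col_mx (0 : 'cV_q) v) = vec_norm v.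
  by apply/(@pexpIrn _ 2) => //; rewrite ?nnegrE ?vec_norm_ge0//
    vec_norm_col_mx vec_norm0 expr0n add0r.
have mx0 p (U : 'M[BL H]_p) : mxop U 0 = 0.
  by apply/colP => i; rewrite mxopE mxE big1// => k _; rewrite mxE linear0.
rewrite ge_max; apply/andP; split; apply: bl_mxnorm_le; rewrite ?bl_mxnorm_ge0// => v.
  by have := bl_mxnorm_bound (block_mx S 0 0 T) (col_mx v 0);
    rewrite mxop_block mx0 !col0.
by have := bl_mxnorm_bound (block_mx S 0 0 T) (col_mx 0 v);
  rewrite mxop_block mx0 !col0'.
Qed.

End BoundedOperatorTheory.

(** * The Riesz representation theorem and adjoints *)

Section RieszAdjoint.
Variables (R : realType) (H : hilbert R).
Notation C := R[i].
Notation ip := (hs_ip H).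
Notation hn := (hnorm ip).
Implicit Types S T : BL H.

Lemma Re_ip_le (x y : H) : complex.Re (ip x y) <= hn x * hn y.
Proof. exact: le_trans (Re_le_normc _) (dot_le_hnorm _ _ _). Qed.

Lemma quadratic_ge0_linear0 (a b : R) : 0 <= a ->
  (forall t, 0 <= t ^+ 2 * a + t * b) -> b = 0.
Proof.
move=> a0 ab; have a1 : 0 < a + 1 by rewrite ltr_wpDl.
have := ab (- b / (a + 1)).
have -> : (- b / (a + 1)) ^+ 2 * a + - b / (a + 1) * b = - (b / (a + 1)) ^+ 2.
  by field; rewrite gt_eqF.
rewrite oppr_ge0 => b0; have /eqP : (b / (a + 1)) ^+ 2 = 0.
  by apply/eqP; rewrite eq_le b0 sqr_ge0.
by rewrite sqrf_eq0 mulf_eq0 invr_eq0 (gt_eqF a1) orbF => /eqP.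
Qed.

(** Discards an arbitrarily small error; in [riesz] it lets near-minimizers stand in for their
    limit. *)
Lemma eq0_small (a b : R) : 0 <= b -> (forall e, 0 < e -> - (e * b) <= a) -> 0 <= a.
Proof.
move=> b0 ab; rewrite leNgt; apply/negP => a0.
have b1 : 0 < b + 1 by rewrite ltr_wpDl.
have e0 : 0 < - a / (b + 1) by rewrite divr_gt0// oppr_gt0.
have : - a / (b + 1) * (b + 1) = - a by rewrite divfK// gt_eqF.
have := ab _ e0; move: (- a / _) e0 => e; lra.
Qed.

(* The representing vector minimizes [|x|^2 - 2 Re (g x)]; the parallelogram
   law makes every minimizing sequence Cauchy. *)
Lemma riesz (g : H -> C) c : linear_for *%R g -> 0 <= c ->
  (forall x, Normc.normc (g x) <= c * hn x) ->
  exists y, forall x, g x = ip x y.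
Proof.
move=> lg c0 gc.
have gD x y : g (x + y) = g x + g y by have := lg 1 x y; rewrite scale1r mul1r.
have g0 : g 0 = 0 by apply: (addrI (g 0)); rewrite -gD !addr0.
have gZ a x : g (a *: x) = a * g x by have := lg a x 0; rewrite !addr0 g0 addr0.
pose J x := hn x ^+ 2 - 2 * complex.Re (g x).
have J_ge x : - c ^+ 2 <= J x.
  have := le_trans (Re_le_normc _) (gc x); rewrite /J; have := sqr_ge0 (hn x - c).
  by rewrite sqrrB; nra.
have inf_ge : has_inf (range J).
  by split; [exists (J 0), 0|exists (- c ^+ 2) => _ [x _ <-]].
set m := inf (range J).
have mJ x : m <= J x by apply: ge_inf; [exact: inf_ge.2|exists x].
have para x y : hn (x - y) ^+ 2 <= 2 * (J x - m) + 2 * (J y - m).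
  (* The test vector is the midpoint, where [J] cannot fall below [m]. *)
  have := mJ ((2^-1)%:C%C *: (x + y)); rewrite /J hnormZ gZ normc_real ?invr_ge0//.
  rewrite exprMn gD hnormDsqr -[x - y]/(x + - y) hnormDsqr hnormN linearNr /= raddfN /=.
  have -> (z : C) : complex.Re ((2^-1)%:C%C * z) = 2^-1 * complex.Re z.
    by case: z => a b /=; rewrite mul0r subr0.
  rewrite raddfD /=; lra.
have /choice[u uP] (n : nat) : exists x, J x < m + n.+1%:R^-1.
  have [|_ [x _ <-] Jx] := @inf_adherent _ (range J) n.+1%:R^-1 _ inf_ge.
    by rewrite invr_gt0.
  by exists x.
have small (e : R) : 0 < e -> exists k, forall n, (k <= n)%N -> n.+1%:R^-1 < e.
  move=> e0; exists (Num.trunc e^-1) => n kn.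
  rewrite invf_plt ?posrE//; have := truncnS_gt e^-1.
  by move=> /lt_le_trans; apply; rewrite ler_nat.
have [|l lP] := hs_complete (u := u).
  (* In [para] each of the two excesses over [m] enters with factor 2, hence the quarter. *)
  move=> e e0; have [|k kP] := small (e ^+ 2 / 4); first by rewrite divr_gt0 ?exprn_gt0.
  exists k => p q /kP kp /kP kq.
  rewrite -(@ltr_pXn2r _ 2)// ?nnegrE ?hnorm_ge0 ?ltW//.
  apply: le_lt_trans (para _ _) _; have := uP p; have := uP q.
  move: (J (u p)) (J (u q)) (p.+1%:R^-1) (q.+1%:R^-1) kp kq => ? ? ? ?; lra.
have ReE h : complex.Re (g h) = complex.Re (ip h l).
  suff : complex.Re (ip h l) - complex.Re (g h) = 0 by lra.
  suff : 2 * (complex.Re (ip h l) - complex.Re (g h)) = 0 by lra.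
  apply: (@quadratic_ge0_linear0 (hn h ^+ 2)); first exact: sqr_ge0.
  (* Compare [J] at [u n] and at [u n + t h]. Replacing [u n] by [l] in the inner product costs at
     most [2 * |t| * hn h * e], and near-minimality of [u n] costs the remaining [e]. *)
  move=> t; apply: (@eq0_small _ (2 * `|t| * hn h + 1)).
    by rewrite addr_ge0// !mulr_ge0 ?hnorm_ge0.
  move=> e e0; have [k1 k1P] := small _ e0; have [k2 k2P] := lP _ e0.
  set n := maxn k1 k2; have := k1P n (leq_maxl _ _); have := k2P n (leq_maxr _ _).
  have := mJ (u n + t%:C%C *: h); have := uP n.
  rewrite /J hnormDsqr hnormZ gD gZ raddfD linearZr_LR.
  have -> : Normc.normc t%:C%C = `|t|.
    by apply: complexI; rewrite -normcCE normc_def /= expr0n addr0 sqrtr_sqr.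
  rewrite /=.
  have ReZ (z : C) : complex.Re (t%:C%C * z) = t * complex.Re z.
    by case: z => a b /=; rewrite mul0r subr0.
  have -> : (t%:C%C)^* = t%:C%C :> C by rewrite conj_Creal//; apply/complex_realP; exists t.
  rewrite !ReZ exprMn real_normK ?num_real//.
  have hE : complex.Re (ip (u n) h) = complex.Re (ip h l) + complex.Re (ip (u n - l) h).
    by rewrite linearBl /= raddfB /= -[ip l h]/(ip l h) (hnorm_dotC _ h l) Re_conjC; ring.
  have h1 : t * complex.Re (ip (u n - l) h) <= `|t| * (hn (u n - l) * hn h).
    apply: le_trans (ler_norm _) _; rewrite normrM ler_wpM2l// ler_norml Re_ip_le andbT.
    by rewrite lerNl -raddfN /= -linearNl -(hnormN _ (u n - l)) Re_ip_le.
  rewrite hE => Jn mn ln sn.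
  have h2 : `|t| * (hn (u n - l) * hn h) <= `|t| * hn h * e.
    by rewrite mulrCA mulrC ler_wpM2l ?mulr_ge0 ?hnorm_ge0// ltW.
  move: h1 => /le_trans/(_ h2) h1; move: (n.+1%:R^-1) Jn sn => s; lra.
exists l => x; apply/eqP; rewrite eq_complex ReE eqxx /=.
(* The real part at [i x] is minus the imaginary part at [x]. *)
have := ReE ('i%C *: x); rewrite gZ linearZl_LR /= mulrC ReiNIm mulrC ReiNIm.
by move/oppr_inj ->.
Qed.

Lemma adjoint_exists T : exists S : BL H, forall x y, ip (T x) y = ip x (S y).
Proof.
have [c c0 Tc] := bl_hnorm_bound T.
have /choice[S SP] y : exists z, forall x, ip (T x) y = ip x z.
  apply: (@riesz (fun x => ip (T x) y) (c * hn y)).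
  - by move=> a u v; rewrite linearP linearDl /= linearZl_LR.
  - by rewrite mulr_ge0 ?hnorm_ge0.
  - move=> x; apply: le_trans (dot_le_hnorm _ _ _) _.
    by rewrite mulrAC ler_wpM2r ?hnorm_ge0.
have bS : S \in bounded_linear (H := H).
  apply/asboolP; split.
    move=> a u v; apply: (dot_inj (f := ip)) => x.
    by rewrite -SP !(linearDr, linearZr_LR) /= -!SP.
  (* Cancel [hn (S y)] in |S y|^2 = <T (S y), y> <= c |S y| |y|. *)
  exists c => y; have := hnorm_ge0 ip (S y); rewrite le_eqVlt => /predU1P[<-|Sy0].
    by rewrite mulr_ge0 ?hnorm_ge0.
  rewrite -(ler_pM2l Sy0) -expr2 hnorm_sqr -SP; apply: le_trans (Re_ip_le _ _) _.
  by rewrite mulrCA mulrA ler_wpM2r ?hnorm_ge0.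
by exists (MkBL bS).
Qed.

Lemma adjointP T x y : ip (T x) y = ip x (adjoint T y).
Proof.
have [S SP] := adjoint_exists T.
exact: (xgetI (0 : BL H) (P := [set S : BL H | forall x y, ip (T x) y = ip x (S y)]) SP).
Qed.

Lemma adjoint_unique T S : (forall x y, ip (T x) y = ip x (S y)) -> adjoint T = S.
Proof.
by move=> TS; apply: bl_ext => y; apply: (dot_inj (f := ip)) => x; rewrite -adjointP TS.
Qed.

Lemma adjointPl T x y : ip (adjoint T x) y = ip x (T y).
Proof. by rewrite hnorm_dotC -adjointP -hnorm_dotC. Qed.

Lemma adjointK T : adjoint (adjoint T) = T.
Proof. by apply: adjoint_unique => x y; rewrite adjointPl. Qed.

Lemma adjointM S T : adjoint (bl_comp S T) = bl_comp (adjoint T) (adjoint S).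
Proof. by apply: adjoint_unique => x y /=; rewrite !adjointP. Qed.

Lemma adjoint_conj_linear c S T : adjoint (c *: S + T) = c^* *: adjoint S + adjoint T.
Proof.
apply: adjoint_unique => x y; rewrite !bl_addE !bl_scaleE linearDl /= linearZl_LR.
by rewrite linearDr linearZr_LR /= conjCK !adjointP.
Qed.

End RieszAdjoint.

(** * Scalar matrices acting on columns of vectors *)

Section ScalarAction.
Variables (R : realType) (H : hilbert R).
Notation C := R[i].
Notation ip := (hs_ip H).
Notation hn := (hnorm ip).

(** The Gram matrix of [v] is [c c^*]: row [j] of [c] plays the role of orthonormal coordinates of
    entry [j]. The width [p] is free because [lscale] changes only the number of rows. *)
Definition gram_factor n p (v : 'cV[H]_n) (c : 'M[C]_(n, p)) :=
  forall j l, ip (v j 0) (v l 0) = \sum_k c j k * (c l k)^*.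

(** Cholesky factorization by Gram-Schmidt: project the remaining entries off the first one, factor
    their Gram matrix by induction, and restore the projections in an extra column. *)
Lemma gram_factor_exists n (v : 'cV[H]_n) : exists c : 'M[C]_n, gram_factor v c.
Proof.
elim: n v => [|n IH] v; first by exists 0 => -[].
pose v0 := v ord0 0; pose w j := v (lift ord0 j) 0.
(* Stated without a quotient so that [v0 = 0], where both sides vanish, is included. *)
have /choice[a aE] j : exists z, z * ip v0 v0 = ip (w j) v0.
  exists (ip (w j) v0 / ip v0 v0); have [v00|v0n] := eqVneq v0 0.
    by rewrite v00 !linear0r mulr0.
  by rewrite divfK// dnorm_eq0.
have [c cP] := IH (\col_j (w j - a j *: v0)).
have wE j l : ip (w j) (w l) =
    \sum_k c j k * (c l k)^* + a j * ip v0 v0 * (a l)^*.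
  rewrite -cP !mxE !(linearBl, linearBr) /= !linearZl_LR /= !linearZr_LR /=.
  rewrite (hnorm_dotC _ v0 (w l)) -!aE rmorphM /=.
  have -> : (ip v0 v0)^* = ip v0 v0 by rewrite -hnorm_dotC.
  ring.
pose s : C := (hn v0)%:C%C.
have sE : s * s^* = ip v0 v0.
  rewrite conj_Creal; last by apply/complex_realP; exists (hn v0).
  by rewrite -expr2 dot_hnorm rmorphXn.
(* The first row is [(s, 0, ..., 0)], the first column continues with [a j * s], and [c] fills the
   rest. *)
pose B : 'M[C]_n.+1 := \matrix_(j, k)
  if unlift ord0 j is Some j' then if unlift ord0 k is Some k' then c j' k' else a j' * s
  else if unlift ord0 k is Some _ then 0 else s.
have B00 : B ord0 ord0 = s by rewrite mxE unlift_none.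
have B01 k : B ord0 (lift ord0 k) = 0 by rewrite mxE unlift_none liftK.
have B10 j : B (lift ord0 j) ord0 = a j * s by rewrite mxE unlift_none liftK.
have B11 j k : B (lift ord0 j) (lift ord0 k) = c j k by rewrite mxE !liftK.
exists B.
have wC j : ip v0 (w j) = ip v0 v0 * (a j)^*.
  by rewrite hnorm_dotC -aE rmorphM /= -hnorm_dotC mulrC.
move=> j l; case: (unliftP ord0 j) => [j'|] ->; case: (unliftP ord0 l) => [l'|] ->;
  rewrite big_ord_recl ?(B00, B01, B10).
- rewrite -/(w j') -/(w l') wE addrC; congr (_ + _).
    by rewrite rmorphM -sE /=; ring.
  by apply: eq_bigr => k _; rewrite !B11.
- rewrite -/v0 -/(w j') -mulrA sE [RHS]addrC big1 ?add0r ?aE//.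
  by move=> k _; rewrite B01 rmorph0 mulr0.
- rewrite -/v0 -/(w l') rmorphM mulrCA sE [RHS]addrC big1 ?add0r.
    by rewrite wC mulrC.
  by move=> k _; rewrite B01 mul0r.
- rewrite -/v0 sE big1 ?addr0// => k _.
  by rewrite B01 mul0r.
Qed.

Lemma normc_sqr (z : C) : Normc.normc z ^+ 2 = complex.Re (z * z^*).
Proof. by apply: complexI; rewrite rmorphXn /= -normcCE -normCK normcCE -rmorphXn. Qed.

Lemma gram_factor_norm n p (v : 'cV[H]_n) (c : 'M[C]_(n, p)) :
  gram_factor v c -> vec_norm v ^+ 2 = \sum_k cvec_norm (col k c) ^+ 2.
Proof.
move=> vc; rewrite vec_norm_l2 l2norm_sqr.
under [RHS]eq_bigr => k _ do rewrite [cvec_norm _ ^+ 2]l2norm_sqr.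
rewrite exchange_big /=; apply: eq_bigr => i _.
rewrite hnorm_sqr vc raddf_sum; apply: eq_bigr => k _.
by rewrite mxE normc_sqr.
Qed.

Lemma gram_factor_lscale m n p (a : 'M[C]_(m, n)) (v : 'cV[H]_n) (c : 'M[C]_(n, p)) :
  gram_factor v c -> gram_factor (lscale a v) (a *m c).
Proof.
move=> vc j l; rewrite !mxE.
rewrite (big_morph (ip^~ _) (linearDl ip _) (linear0l ip _)).
under eq_bigr => i _ do rewrite raddf_sum.
transitivity (\sum_i \sum_k \sum_q a j i * c i q * ((a l k)^* * (c k q)^*)).
  apply: eq_bigr => i _; apply: eq_bigr => k _.
  rewrite /= linearZl_LR linearZr_LR /= vc mulr_sumr mulr_sumr.
  by apply: eq_bigr => q _; ring.
under eq_bigr do rewrite exchange_big /=.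
rewrite exchange_big /=; apply: eq_bigr => q _; rewrite !mxE rmorph_sum /= mulr_suml.
apply: eq_bigr => i _; rewrite mulr_sumr; apply: eq_bigr => k _.
by rewrite rmorphM.
Qed.

(* The Gram matrix of [v] factors as [c c^*], which reduces the claim to the
   columns of [c]. *)
Lemma vec_norm_lscale m n (a : 'M[C]_(m, n)) (v : 'cV[H]_n) :
  vec_norm (lscale a v) <= scalar_mxnorm a * vec_norm v.
Proof.
have [c vc] := gram_factor_exists v.
rewrite -(@ler_pXn2r _ 2)// ?nnegrE ?mulr_ge0 ?vec_norm_ge0 ?scalar_mxnorm_ge0//.
rewrite exprMn (gram_factor_norm vc) (gram_factor_norm (gram_factor_lscale a vc)).
rewrite mulr_sumr; apply: ler_sum => k _; rewrite -exprMn.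
rewrite ler_pXn2r ?nnegrE ?mulr_ge0 ?cvec_norm_ge0 ?scalar_mxnorm_ge0//.
suff -> : col k (a *m c) = a *m col k c by exact: scalar_mxnorm_bound.
by apply/colP => i; rewrite !mxE; apply: eq_bigr => j _; rewrite mxE.
Qed.

Lemma mxop_lrscale m n (a : 'M[C]_(m, n)) (T : 'M[BL H]_n) (b : 'M[C]_(n, m)) v :
  mxop (rscale (lscale a T) b) v = lscale a (mxop T (lscale b v)).
Proof.
transitivity (mxop (lscale a T) (lscale b v)).
  apply: mxprodA => //=; first by move=> U c x; rewrite linearZ.
  - by move=> U x y; exact: linearD.
  - by move=> U; exact: linear0.
apply: mxprodA => //=; first by move=> U x y; exact: scalerDr.
by move=> U; exact: scaler0.
Qed.

Lemma bl_mxnorm_scale m n (a : 'M[C]_(m, n)) (T : 'M[BL H]_n) (b : 'M[C]_(n, m)) :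
  bl_mxnorm H m (rscale (lscale a T) b) <=
    scalar_mxnorm a * bl_mxnorm H n T * scalar_mxnorm b.
Proof.
apply: bl_mxnorm_le => [|v].
  by rewrite !mulr_ge0 ?scalar_mxnorm_ge0 ?bl_mxnorm_ge0.
rewrite mxop_lrscale; apply: le_trans (vec_norm_lscale _ _) _.
rewrite -!mulrA ler_wpM2l ?scalar_mxnorm_ge0//.
apply: le_trans (bl_mxnorm_bound _ _) _.
by rewrite ler_wpM2l ?bl_mxnorm_ge0 ?vec_norm_lscale.
Qed.

End ScalarAction.

(** * Completeness of the bounded operators *)

Section Completeness.
Variables (R : realType) (H : hilbert R).
Notation hn := (hnorm (hs_ip H)).
Notation opn := (norm1 (bl_mxnorm H)).

Definition hcvg (u : nat -> H) (l : H) :=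
  forall e : R, 0 < e -> exists k, forall n, (k <= n)%N -> hn (u n - l) < e.

Lemma hcvg_unique u l l' : hcvg u l -> hcvg u l' -> l = l'.
Proof.
move=> ul ul'; apply/eqP; rewrite -subr_eq0; apply/eqP/(@hnorm_eq0 _ _ (hs_ip H)).
apply/eqP; rewrite eq_le hnorm_ge0 andbT leNgt; apply/negP => d0.
have d20 : 0 < hn (l - l') / 2 by rewrite divr_gt0.
have [k kP] := ul _ d20; have [k' kP'] := ul' _ d20.
have := kP _ (leq_maxl k k'); have := kP' _ (leq_maxr k k').
have := hnorm_triangle (hs_ip H) (u (maxn k k')) l l'.
rewrite (hnormBC _ l (u _)); lra.
Qed.

Lemma hcvg_linear c u v l l' : hcvg u l -> hcvg v l' ->
  hcvg (fun n => c *: u n + v n) (c *: l + l').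
Proof.
move=> ul vl e e0; have c0 := normc_ge0 c.
have e1 : 0 < e / 2 / (Normc.normc c + 1) by rewrite !divr_gt0// ltr_wpDl.
have e2 : 0 < e / 2 by rewrite divr_gt0.
have [k kP] := ul _ e1; have [k' kP'] := vl _ e2.
exists (maxn k k') => n; rewrite geq_max => /andP[/kP kn /kP' kn'].
rewrite opprD addrACA -scalerBr; apply: le_lt_trans (hnormD _ _ _) _.
rewrite hnormZ [ltRHS](splitr e) ler_ltD//; move: kn.
rewrite ltr_pdivlMr ?ltr_wpDl// => kn; apply: le_trans (ltW kn).
by rewrite mulrC ler_wpM2l ?hnorm_ge0// lerDl.
Qed.

Lemma hcvg_hnorm_le u l y c k : hcvg u l ->
  (forall n, (k <= n)%N -> hn (u n - y) <= c) -> hn (l - y) <= c.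
Proof.
move=> ul uc; apply/ler_addgt0Pr => e /ul[k' kP].
have := uc _ (leq_maxl k k'); have := kP _ (leq_maxr k k').
have := hnorm_triangle (hs_ip H) (u (maxn k k')) l y.
rewrite (hnormBC _ l (u _)); lra.
Qed.

Lemma bl_complete : seq_complete opn.
Proof.
move=> u cu.
have /choice[L LP] x : exists l, hcvg (fun n => u n x) l.
  apply: hs_complete => e e0.
  have [|k kP] := cu (e / (hn x + 1)); first by rewrite divr_gt0// ltr_wpDl ?hnorm_ge0.
  exists k => m n km kn; have := kP m n km kn.
  rewrite ltr_pdivlMr ?ltr_wpDl ?hnorm_ge0// => /le_lt_trans; apply.
  apply: le_trans (opnorm_bound (u m - u n) x) _.
  by rewrite ler_wpM2l ?opnorm_ge0// lerDl.
(* Letting [m] tend to infinity keeps [k] independent of [x], which upgrades pointwise to norm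
   convergence. *)
have LB e k : (forall m n, (k <= m)%N -> (k <= n)%N -> opn (u m - u n) < e) ->
    forall n x, (k <= n)%N -> hn (L x - u n x) <= e * hn x.
  move=> kP n x kn; apply: (@hcvg_hnorm_le _ _ _ _ k (LP x)) => m km.
  apply: le_trans (opnorm_bound (u m - u n) x) _.
  by rewrite ler_wpM2r ?hnorm_ge0// ltW// kP.
have bL : L \in bounded_linear (H := H).
  apply/asboolP; split.
    move=> a x y; apply: (hcvg_unique (LP _)).
    have -> : (fun n => u n (a *: x + y)) = (fun n => a *: u n x + u n y).
      by apply/funext => n; rewrite linearP.
    exact: hcvg_linear.
  have [k kP] := cu 1 ltr01; exists (1 + opn (u k)) => x.
  rewrite mulrDl -[L x](subrK (u k x)); apply: le_trans (hnormD _ _ _) _.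
  by apply: lerD; [exact: LB kP _ _ (leqnn k)|exact: opnorm_bound].
(* The limit only preserves weak inequalities; half of [e] restores the strict one. *)
exists (MkBL bL) => e e0; have [|k kP] := cu (e / 2); first by rewrite divr_gt0.
exists k => n kn; apply: (@le_lt_trans _ _ (e / 2)); last by rewrite ltr_pdivrMr// ltr_pMr// ltr1n.
apply: opnorm_le => [|x]; first by rewrite divr_ge0// ltW.
by rewrite -[leLHS]hnormN opprB; exact: (LB _ _ kP).
Qed.

Lemma bl_operator_space : is_operator_space (bl_mxnorm H).
Proof.
split.
- exact: bl_mxnorm_eq0.
- exact: bl_mxnormZ.
- exact: bl_mxnormD.
- exact: bl_complete.
- exact: bl_mxnorm_scale.
- exact: bl_mxnorm_block.
Qed.

End Completeness.

(** * Norm closures in operator spaces *)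

Section OperatorSpaceNorm.
Variables (R : realType) (V : lmodType R[i]) (N : matnorm V).
Hypothesis hN : is_operator_space N.
Notation nr := (norm1 N).
Notation clo := (norm_closure nr).

(** Not an axiom, but 0 = N (x - x) <= N x + N (- x) = 2 N x. *)
Lemma os_norm_ge0 n (x : 'M[V]_n) : 0 <= N x.
Proof.
have scale (c : R[i]) y : map_mx ( *:%R c) x = y -> N y = Normc.normc c * N x.
  by move=> <-; exact: (os_homog hN).
have N0 : @N n 0 = 0.
  rewrite (scale 0) ?Normc.normc0 ?mul0r//.
  by apply/matrixP => i j; rewrite !mxE scale0r.
have NN : N (- x) = N x.
  rewrite (scale (- 1)) ?normcN ?Normc.normc1 ?mul1r//.
  by apply/matrixP => i j; rewrite !mxE scaleN1r.
by have := os_triangle hN x (- x); rewrite subrr N0 NN; lra.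
Qed.

Lemma norm1_ge0 x : 0 <= nr x. Proof. exact: os_norm_ge0. Qed.

Lemma norm1Z c x : nr (c *: x) = Normc.normc c * nr x.
Proof.
rewrite /norm1 -(os_homog hN); congr (@N 1%N _).
by apply/matrixP => i j; rewrite !mxE.
Qed.

Lemma norm1D x y : nr (x + y) <= nr x + nr y.
Proof. by rewrite /norm1 raddfD; exact: (os_triangle hN). Qed.

Lemma norm1_0 : nr 0 = 0.
Proof. by rewrite -(scale0r 0) norm1Z Normc.normc0 mul0r. Qed.

Lemma norm1N x : nr (- x) = nr x.
Proof. by rewrite -scaleN1r norm1Z normcN Normc.normc1 mul1r. Qed.

Lemma norm1_triangle z x y : nr (x - y) <= nr (x - z) + nr (z - y).
Proof. by apply: le_trans (norm1D _ _); rewrite addrA subrK. Qed.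

Lemma sub_closure (S : set V) : S `<=` clo S.
Proof. by move=> x Sx e e0; exists x => //; rewrite subrr norm1_0. Qed.

Lemma closure_idem (S : set V) : clo (clo S) `<=` clo S.
Proof.
move=> x Sx e e0; have e20 : 0 < e / 2 by rewrite divr_gt0.
have [y Sy xy] := Sx _ e20; have [z Sz yz] := Sy _ e20.
by exists z => //; have := norm1_triangle y x z; lra.
Qed.

Lemma closure_sub (S T : set V) : S `<=` clo T -> clo S `<=` clo T.
Proof.
move=> ST x Sx; apply: closure_idem => e /Sx[y Sy xy].
by exists y => //; exact: ST.
Qed.

Lemma closure_subspace (S : set V) : linear_subspace S -> linear_subspace (clo S).
Proof.
move=> [S0 SD]; split; first exact: sub_closure.
move=> c x y Sx Sy e e0; have c0 := normc_ge0 c.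
have c1 : 0 < Normc.normc c + 1 by rewrite ltr_wpDl.
have e1 : 0 < e / 2 / (Normc.normc c + 1) by rewrite !divr_gt0.
have e2 : 0 < e / 2 by rewrite divr_gt0.
have [x' Sx' xx] := Sx _ e1; have [y' Sy' yy] := Sy _ e2.
exists (c *: x' + y'); first exact: SD.
rewrite opprD addrACA -scalerBr; apply: le_lt_trans (norm1D _ _) _.
rewrite norm1Z [ltRHS](splitr e) ler_ltD//; move: xx.
rewrite ltr_pdivlMr// => xx; apply: le_trans (ltW xx).
by rewrite mulrC ler_wpM2l ?norm1_ge0// lerDl.
Qed.

End OperatorSpaceNorm.

(** Only differences must be preserved, so the conjugate-linear involution is covered along with the
    linear maps. *)
Lemma closure_image (R : realType) (V W : lmodType R[i]) (N : matnorm V) (N' : matnorm W)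
    (hN : is_operator_space N) (f : V -> W) (c : R) (S : set V) (S' : set W) :
  {morph f : x y / x - y} -> (forall x, norm1 N' (f x) <= c * norm1 N x) ->
  (forall x, S x -> S' (f x)) ->
  forall x, norm_closure (norm1 N) S x -> norm_closure (norm1 N') S' (f x).
Proof.
move=> fB fc SS' x Sx e e0; have c1 : 0 < `|c| + 1 by rewrite ltr_wpDl.
have [y Sy] := Sx _ (divr_gt0 e0 c1); rewrite ltr_pdivlMr// => xy.
exists (f y); first exact: SS'.
rewrite -fB; apply: le_lt_trans (fc _) (le_lt_trans _ xy).
by rewrite mulrC ler_wpM2l ?norm1_ge0// (le_trans (ler_norm c))// lerDl.
Qed.

Section OperatorClosure.
Variables (R : realType) (H : hilbert R).
Notation opn := (norm1 (bl_mxnorm H)).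

Lemma opnorm_comp (S T : BL H) : opn (bl_comp S T) <= opn S * opn T.
Proof.
apply: opnorm_le => [|x]; first by rewrite mulr_ge0 ?opnorm_ge0.
apply: le_trans (opnorm_bound S (T x)) _.
by rewrite -mulrA ler_wpM2l ?opnorm_ge0 ?opnorm_bound.
Qed.

Lemma closure_comp (A : set (BL H)) :
  (forall S T, A S -> A T -> A (bl_comp S T)) ->
  forall S T, norm_closure opn A S -> norm_closure opn A T ->
    norm_closure opn A (bl_comp S T).
Proof.
move=> AM S T AS AT e e0; have hN := bl_operator_space H.
have S1 : 0 < opn S + 1 by rewrite ltr_wpDl ?opnorm_ge0.
have e20 : 0 < e / 2 by rewrite divr_gt0.
(* [T'] comes first because the accuracy required of [S'] depends on the norm of [T']. *)
have [T' AT'] := AT _ (divr_gt0 e20 S1); rewrite ltr_pdivlMr// => TT.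
have T1 : 0 < opn T' + 1 by rewrite ltr_wpDl ?opnorm_ge0.
have [S' AS'] := AS _ (divr_gt0 e20 T1); rewrite ltr_pdivlMr// => SS.
exists (bl_comp S' T'); first exact: AM.
have -> : bl_comp S T - bl_comp S' T' = bl_comp S (T - T') + bl_comp (S - S') T'.
  rewrite bl_compDr bl_compDl -[- T']scaleN1r bl_compZr -[- S']scaleN1r bl_compZl !scaleN1r.
  by rewrite addrA subrK.
apply: le_lt_trans (norm1D hN _ _) _; have := opnorm_comp S (T - T').
have := opnorm_comp (S - S') T'.
have := opnorm_ge0 (T - T'); have := opnorm_ge0 (S - S'); nra.
Qed.

End OperatorClosure.

(** * Adjoints of operator matrices and the twisted involution *)

Section MatrixAdjoint.
Variables (R : realType) (H : hilbert R).
Notation ip := (hs_ip H).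
Notation hn := (hnorm ip).

Lemma vec_ip_adjoint n (T : 'M[BL H]_n) v w :
  vec_ip (mxop T v) w = vec_ip v (mxop (map_mx (@adjoint R H) T^T) w).
Proof.
rewrite !vec_ipE.
under eq_bigr => i _ do rewrite mxopE (big_morph (ip^~ _) (linearDl ip _) (linear0l ip _)).
rewrite exchange_big /=; apply: eq_bigr => k _.
by rewrite mxopE raddf_sum; apply: eq_bigr => i _; rewrite !mxE adjointP.
Qed.

Lemma bl_mxnorm_adjoint_le n (T : 'M[BL H]_n) :
  bl_mxnorm H n (map_mx (@adjoint R H) T^T) <= bl_mxnorm H n T.
Proof.
apply: bl_mxnorm_le => [|w]; first exact: bl_mxnorm_ge0.
set v := mxop _ w; have := vec_norm_ge0 v; rewrite le_eqVlt => /predU1P[<-|v0].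
  by rewrite mulr_ge0 ?bl_mxnorm_ge0 ?vec_norm_ge0.
(* With [v = T^* w], cancel |v| in |v|^2 = <T v, w> <= |T| |v| |w|. *)
rewrite -(ler_pM2l v0) -expr2 vec_norm_sqr {2}/v -vec_ip_adjoint.
apply: le_trans (Re_le_normc _) _; apply: le_trans (vec_ip_le _ _) _.
by rewrite mulrA ler_wpM2r ?vec_norm_ge0// mulrC bl_mxnorm_bound.
Qed.

Variable U : BL H.

(** For a selfadjoint unitary [U] this is the Krein space adjoint, taken with respect to the
    indefinite form <U x, y>. *)
Definition twisted_adjoint (T : BL H) : BL H := bl_comp U (bl_comp (adjoint T) U).

Lemma twisted_adjoint_conj_linear c S T :
  twisted_adjoint (c *: S + T) = c^* *: twisted_adjoint S + twisted_adjoint T.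
Proof.
by rewrite /twisted_adjoint adjoint_conj_linear bl_compDl bl_compDr bl_compZl bl_compZr.
Qed.

Lemma twisted_adjointD : {morph twisted_adjoint : S T / S + T}.
Proof. by move=> S T; have := twisted_adjoint_conj_linear 1 S T; rewrite rmorph1 !scale1r. Qed.

Lemma twisted_adjoint0 : twisted_adjoint 0 = 0.
Proof. by apply: (addrI (twisted_adjoint 0)); rewrite -twisted_adjointD !addr0. Qed.

Lemma twisted_adjointB : {morph twisted_adjoint : S T / S - T}.
Proof.
move=> S T; rewrite -[- T]scaleN1r addrC twisted_adjoint_conj_linear.
by rewrite rmorphN rmorph1 scaleN1r addrC.
Qed.

Hypothesis hU : selfadjoint_unitary U.

Lemma twisted_adjointK : involutive twisted_adjoint.
Proof.
have [U1 U2] := hU => T; rewrite /twisted_adjoint !adjointM adjointK U1.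
by rewrite !bl_compA U2 bl_comp1l -bl_compA U2 bl_comp1r.
Qed.

Lemma twisted_adjointM S T :
  twisted_adjoint (bl_comp S T) = bl_comp (twisted_adjoint T) (twisted_adjoint S).
Proof.
have [U1 U2] := hU; rewrite /twisted_adjoint adjointM !bl_compA.
by rewrite -(bl_compA _ U U) U2 bl_comp1r.
Qed.

Lemma unitary_vec_norm n (v : 'cV[H]_n) : vec_norm (map_mx U v) = vec_norm v.
Proof.
have [U1 U2] := hU; congr Num.sqrt; apply: eq_bigr => i _; rewrite mxE !hnorm_sqr.
by rewrite adjointP U1 -[U (U _)]/(bl_comp U U _) U2.
Qed.

(** Applying [U] entrywise is isometric on columns, so the bound for adjoints carries over; for an
    involution one inequality yields equality. *)
Lemma bl_mxnorm_twisted_adjoint n (T : 'M[BL H]_n) :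
  bl_mxnorm H n (map_mx twisted_adjoint T^T) = bl_mxnorm H n T.
Proof.
have le (S : 'M[BL H]_n) : bl_mxnorm H n (map_mx twisted_adjoint S^T) <= bl_mxnorm H n S.
  apply: bl_mxnorm_le => [|v]; first exact: bl_mxnorm_ge0.
  have -> : mxop (map_mx twisted_adjoint S^T) v =
      map_mx U (mxop (map_mx (@adjoint R H) S^T) (map_mx U v)).
    apply/colP => i; rewrite [RHS]mxE !mxopE linear_sum; apply: eq_bigr => k _.
    by rewrite !mxE.
  rewrite unitary_vec_norm; apply: le_trans (bl_mxnorm_bound _ _) _.
  by rewrite unitary_vec_norm ler_wpM2r ?vec_norm_ge0 ?bl_mxnorm_adjoint_le.
apply/eqP; rewrite eq_le le /=; have := le (map_mx twisted_adjoint T^T).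
congr (bl_mxnorm H n _ <= _); apply/matrixP => i j.
by rewrite !mxE twisted_adjointK.
Qed.

Lemma opnorm_twisted_adjoint T :
  norm1 (bl_mxnorm H) (twisted_adjoint T) = norm1 (bl_mxnorm H) T.
Proof.
rewrite /norm1 -bl_mxnorm_twisted_adjoint; congr (bl_mxnorm H 1 _).
by apply/matrixP => i j; rewrite !mxE twisted_adjointK.
Qed.

End MatrixAdjoint.

(** * Two by two operator matrices *)

Section BlockOperators.
Variables (R : realType) (H : hilbert R).
Notation ip := (hs_ip H).

Lemma block_op_linear c (a b d e a' b' d' e' : BL H) :
  c *: block_op a b d e + block_op a' b' d' e' =
  block_op (c *: a + a') (c *: b + b') (c *: d + d') (c *: e + e').
Proof.
apply: bl_ext => x; rewrite bl_addE bl_scaleE.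
by congr pair; rewrite /= scalerDr addrACA.
Qed.

Lemma block_op_comp (a b d e a' b' d' e' : BL H) :
  bl_comp (block_op a b d e) (block_op a' b' d' e') =
  block_op (bl_comp a a' + bl_comp b d') (bl_comp a b' + bl_comp b e')
           (bl_comp d a' + bl_comp e d') (bl_comp d b' + bl_comp e e').
Proof.
apply: bl_ext => x; rewrite /= /block_fun /= !linearD.
by congr pair; rewrite /= addrACA.
Qed.

Lemma adjoint_block_op (a b d e : BL H) :
  adjoint (block_op a b d e) = block_op (adjoint a) (adjoint d) (adjoint b) (adjoint e).
Proof.
apply: adjoint_unique => x y; rewrite /= /dsum_ip /= !linearDl /= !adjointP !linearDr /=.
by rewrite addrACA.
Qed.

Lemma block_op_id : block_op (bl_id H) 0 0 (bl_id H) = bl_id (dsum H).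
Proof.
by apply: bl_ext => -[x y]; rewrite /= /block_fun /= addr0 add0r.
Qed.

Lemma adjoint0 : adjoint (0 : BL H) = 0.
Proof. by apply: adjoint_unique => x y; rewrite linear0l linear0r. Qed.

Lemma diag_selfadjoint_unitary (U : BL H) : selfadjoint_unitary U ->
  selfadjoint_unitary (block_op U 0 0 U).
Proof.
move=> [U1 U2]; split; first by rewrite adjoint_block_op U1 adjoint0.
by rewrite block_op_comp !(bl_comp0l, bl_comp0r, addr0, add0r) U2 block_op_id.
Qed.

Lemma twisted_adjoint_block_op (U a b d e : BL H) :
  twisted_adjoint (block_op U 0 0 U) (block_op a b d e) =
  block_op (twisted_adjoint U a) (twisted_adjoint U d)
           (twisted_adjoint U b) (twisted_adjoint U e).
Proof.
rewrite /twisted_adjoint adjoint_block_op !block_op_comp.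
by rewrite !(bl_comp0l, bl_comp0r, addr0, add0r).
Qed.

(** Continuity of the corner embedding, which carries approximations of [piK k] into the linking
    algebra. *)
Lemma opnorm_block_corner (T : BL H) :
  norm1 (bl_mxnorm (dsum H)) (block_op 0 0 0 T) <= norm1 (bl_mxnorm H) T.
Proof.
apply: opnorm_le => [|x]; first exact: opnorm_ge0.
have dn (z : dsum H) : hnorm (hs_ip (dsum H)) z ^+ 2 = hnorm ip z.1 ^+ 2 + hnorm ip z.2 ^+ 2.
  by rewrite !hnorm_sqr /= /dsum_ip raddfD.
rewrite -(@ler_pXn2r _ 2)// ?nnegrE ?mulr_ge0 ?hnorm_ge0 ?opnorm_ge0//.
rewrite exprMn !dn [_.1]addr0 [_.2]add0r hnorm0 expr0n add0r.
rewrite mulrDr -!exprMn; apply: le_trans (_ : (norm1 (bl_mxnorm H) T * hnorm ip x.2) ^+ 2 <= _).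
  by rewrite ler_pXn2r ?nnegrE ?mulr_ge0 ?hnorm_ge0 ?opnorm_ge0 ?opnorm_bound.
by rewrite lerDr sqr_ge0.
Qed.

End BlockOperators.

(** * Closed subspaces of operator spaces *)

Section SubspaceNorm.
Variables (R : realType) (V : lmodType R[i]) (S : set V) (hS : linear_subspace S).
Variable N : matnorm V.

Lemma subspace_valP (x : subspace hS) : S (subspace_val x).
Proof. by case: x => x /= /asboolP. Qed.

Definition subspace_of (x : V) (Sx : S x) : subspace hS :=
  Subspace (asboolT Sx : x \in subspace_pred hS).

Lemma subspace_val_inj : injective (@subspace_val _ _ _ hS).
Proof. exact: val_inj. Qed.

Lemma subspace_val_linear : linear (@subspace_val _ _ _ hS).
Proof. by move=> c x y; rewrite -[LHS]/(val (c *: x + y)) linearP. Qed.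

Lemma subspace_val0 : subspace_val (0 : subspace hS) = 0.
Proof. exact: (linear0 (val : subspace hS -> V)). Qed.

Lemma subspace_valD : {morph @subspace_val _ _ _ hS : x y / x + y}.
Proof. exact: (linearD (val : subspace hS -> V)). Qed.

Lemma subspace_valB : {morph @subspace_val _ _ _ hS : x y / x - y}.
Proof. exact: (linearB (val : subspace hS -> V)). Qed.

Lemma subspace_valZ c (x : subspace hS) : subspace_val (c *: x) = c *: subspace_val x.
Proof. by rewrite -[RHS]addr0 -subspace_val0 -subspace_val_linear addr0. Qed.

Lemma sub_norm1 (x : subspace hS) : norm1 (sub_norm N) x = norm1 N (subspace_val x).
Proof. by rewrite /norm1 /sub_norm map_const_mx. Qed.

(** The norm axioms restrict along [subspace_val]; closedness of [S] enters in completeness, to keep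
    the limit inside. *)
Lemma sub_operator_space : is_operator_space N ->
  norm_closure (norm1 N) S `<=` S -> is_operator_space (sub_norm (hS := hS) N).
Proof.
move=> hN clS; split.
- move=> n x /(os_eq0 hN) x0; apply/matrixP => i j; apply: subspace_val_inj.
  by have /matrixP/(_ i j) := x0; rewrite !mxE subspace_val0.
- move=> n c x; rewrite -(os_homog hN); congr (@N n _).
  by apply/matrixP => i j; rewrite !mxE subspace_valZ.
- move=> n x y; apply: le_trans (os_triangle hN _ _).
  rewrite le_eqVlt; apply/orP; left; apply/eqP; congr (@N n _).
  by apply/matrixP => i j; rewrite !mxE subspace_valD.
- move=> u cu; have [|l lP] := os_complete hN (u := fun i => subspace_val (u i)).
    move=> e /cu[k kP]; exists k => m n km kn.
    by rewrite /= -subspace_valB -sub_norm1 kP.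
  have Sl : S l.
    apply: clS => e /lP[k /(_ _ (leqnn k))/= uk]; exists (subspace_val (u k)).
      exact: subspace_valP.
    by rewrite -(norm1N hN) opprB.
  exists (subspace_of Sl) => e /lP[k kP]; exists k => n kn.
  by rewrite sub_norm1 subspace_valB kP.
- move=> m n a x b; apply: le_trans (os_scale hN _ _ _).
  rewrite le_eqVlt; apply/orP; left; apply/eqP; congr (@N m _).
  rewrite /rscale /lscale; apply/matrixP => i j; rewrite !mxE.
  rewrite (big_morph _ subspace_valD subspace_val0); apply: eq_bigr => k _.
  rewrite !mxE subspace_valZ (big_morph _ subspace_valD subspace_val0).
  by congr (_ *: _); apply: eq_bigr => l _; rewrite !mxE subspace_valZ.
- move=> m n x y; rewrite -(os_dsum hN); congr (@N _ _).
  rewrite map_block_mx; congr block_mx.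
    by apply/matrixP => i j; rewrite !mxE subspace_val0.
  by apply/matrixP => i j; rewrite !mxE subspace_val0.
Qed.

End SubspaceNorm.

(** * Closed subalgebras invariant under the twisted involution *)

Section OperatorSubalgebra.
Variables (R : realType) (H : hilbert R) (U : BL H) (S : set (BL H)).
Hypothesis hU : selfadjoint_unitary U.
Hypothesis hS : linear_subspace S.
Hypothesis S_closed : norm_closure (norm1 (bl_mxnorm H)) S `<=` S.
Hypothesis S_comp : forall T T', S T -> S T' -> S (bl_comp T T').
Hypothesis S_dag : forall T, S T -> S (twisted_adjoint U T).

Definition sub_comp (x y : subspace hS) : subspace hS :=
  subspace_of hS (S_comp (subspace_valP x) (subspace_valP y)).

Definition sub_dag (x : subspace hS) : subspace hS :=
  subspace_of hS (S_dag (subspace_valP x)).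

Lemma sub_operator_star_algebra :
  is_operator_star_algebra (sub_norm (bl_mxnorm H)) sub_comp sub_dag.
Proof.
split; first split.
- exact: sub_operator_space (bl_operator_space H) S_closed.
- move=> y c x x'; apply: subspace_val_inj.
  apply: etrans (esym (subspace_val_linear c (sub_comp x y) (sub_comp x' y))).
  rewrite -[LHS]/(bl_comp (subspace_val (c *: x + x')) (subspace_val y)).
  by rewrite subspace_val_linear bl_compDl bl_compZl.
- move=> x c y y'; apply: subspace_val_inj.
  apply: etrans (esym (subspace_val_linear c (sub_comp x y) (sub_comp x y'))).
  rewrite -[LHS]/(bl_comp (subspace_val x) (subspace_val (c *: y + y'))).
  by rewrite subspace_val_linear bl_compDr bl_compZr.
- by move=> x y z; apply: subspace_val_inj; exact: bl_compA.
- move=> n x y; apply: le_trans (bl_mxnorm_comp _ _).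
  rewrite le_eqVlt; apply/orP; left; apply/eqP; congr (bl_mxnorm H n _).
  by rewrite (mxprod_map (f := sub_comp) (ga := @subspace_val _ _ _ hS)).
- move=> c x y; apply: subspace_val_inj.
  apply: etrans (esym (subspace_val_linear c^* (sub_dag x) (sub_dag y))).
  rewrite -[LHS]/(twisted_adjoint U (subspace_val (c *: x + y))).
  by rewrite subspace_val_linear twisted_adjoint_conj_linear.
- by move=> x; apply: subspace_val_inj => /=; rewrite twisted_adjointK.
- by move=> x y; apply: subspace_val_inj => /=; rewrite twisted_adjointM.
- move=> n x; rewrite /sub_norm -(bl_mxnorm_twisted_adjoint hU).
  by congr (bl_mxnorm H n _); apply/matrixP => i j; rewrite !mxE /= twisted_adjointK.
Qed.

(** The inclusion is completely isometric, so both constants are 1, and T^* = U (U T^* U) U because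
    [U] squares to the identity. *)
Lemma sub_standard_form_rep :
  is_standard_form_rep (L := OperatorStarAlgebra sub_operator_star_algebra)
    (@subspace_val _ _ _ hS) U.
Proof.
have [U1 U2] := hU; split=> //.
- split.
  + exact: subspace_val_linear.
  + by exists 1 => n x; rewrite mul1r.
  + exact: subspace_val_inj.
  + by exists 1 => n x; rewrite mul1r.
  + move=> T clT; suff ST : S T by exists (subspace_of hS ST).
    apply: S_closed => e /clT[_ [x _ <-] Tx].
    by exists (subspace_val x) => //; exact: subspace_valP.
- move=> x /=; rewrite /twisted_adjoint -!bl_compA U2 bl_comp1r.
  by rewrite bl_compA U2 bl_comp1l.
Qed.

End OperatorSubalgebra.

(** * Algebraic tensors and linear maps *)

Section TensorElements.
Variables (F : fieldType) (X Y : lmodType F).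

(** Scalars are absorbed in the factors, so adding elementary tensors reaches everything. *)
Lemma tensor_ind (P : tensor X Y -> Prop) : P 0 ->
  (forall x y z, P z -> P (tens x y + z)) -> forall z, P z.
Proof.
move=> P0 PS; apply: tensor_piP; elim=> [//|[x y] s /PS].
by move/(_ x y); rewrite -[tens x y + _]/(tensor_add _ _) tensor_addE.
Qed.

End TensorElements.

Section LinearMaps.
Variables (F : pzRingType) (V W : lmodType F) (f : V -> W).
Hypothesis f_linear : linear f.

Lemma linear_fun_D : {morph f : x y / x + y}.
Proof. by move=> x y; have := f_linear 1 x y; rewrite !scale1r. Qed.

Lemma linear_fun_0 : f 0 = 0.
Proof. by apply: (addrI (f 0)); rewrite -linear_fun_D !addr0. Qed.

Lemma linear_fun_B : {morph f : x y / x - y}.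
Proof. by move=> x y; rewrite -[- y]scaleN1r addrC f_linear scaleN1r addrC. Qed.

End LinearMaps.

(** * The linking algebra and its dense algebraic core *)

Section LinkingAlgebra.
Variables (R : realType) (A B : operatorStarAlgebra R) (X : correspondence A B).
Variables (pi : standard_rep X) (K : compacts X) (piK : K -> BL (sr_H pi)).
Hypothesis hpiK : is_compacts_rep piK.

Notation H := (sr_H pi).
Notation C := R[i].
Notation star := (twisted_adjoint (sr_U pi)).
Notation pA := (@sr_A _ _ _ _ pi).
Notation pB := (@sr_B _ _ _ _ pi).
Notation pX := (@sr_X _ _ _ _ pi).
Notation opn := (norm1 (bl_mxnorm H)).

Let hU := sr_unitary pi.
Let pA_linear := cbe_linear (sr_A_embedding pi).
Let pB_linear := cbe_linear (sr_B_embedding pi).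
Let pX_linear := cbe_linear (sr_X_embedding pi).

Definition tensor_compacts (z : tensor X (conj_mod X)) : K :=
  bh_quot (b := K) (ht_incl (bh_tensor K) z).

(** Obtained from [piK], so that the finite sums of pi(x) star(pi(y)) are a well-defined linear
    function of the tensor. *)
Definition tensor_rep (z : tensor X (conj_mod X)) : BL H := piK (tensor_compacts z).

Lemma tensor_compacts_linear : linear tensor_compacts.
Proof. by move=> c x y; rewrite /tensor_compacts ht_incl_linear bh_quot_linear. Qed.

Lemma tensor_rep_linear : linear tensor_rep.
Proof. by move=> c x y; rewrite /tensor_rep tensor_compacts_linear (cr_linear hpiK). Qed.

Let tensor_repD := linear_fun_D tensor_rep_linear.
Let tensor_rep0 := linear_fun_0 tensor_rep_linear.
Let sr_XD := linear_fun_D pX_linear.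
Let sr_X0 := linear_fun_0 pX_linear.

Lemma tensor_rep_tens x y : tensor_rep (tens x (Adj y)) = bl_comp (pX x) (star (pX y)).
Proof. exact: (cr_tens hpiK). Qed.

Let starD := twisted_adjointD (sr_U pi).
Let star0 := twisted_adjoint0 (sr_U pi).

Lemma star_B b : star (pB b) = pB (osa_dag b). Proof. exact: sr_B_dag. Qed.
Lemma star_A a : star (pA a) = pA (osa_dag a). Proof. exact: sr_A_dag. Qed.

Lemma osa_dag_inv (D : operatorStarAlgebra R) : involutive (@osa_dag _ D).
Proof. exact: (osa_dagK (osa_axioms D)). Qed.

Lemma comp_B_starX b y : bl_comp (pB b) (star (pX y)) = star (pX (oc_ract y (osa_dag b))).
Proof. by rewrite sr_ract (twisted_adjointM hU) star_B osa_dag_inv. Qed.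

Lemma comp_starX_A y a : bl_comp (star (pX y)) (pA a) = star (pX (oc_lact (osa_dag a) y)).
Proof. by rewrite sr_lact (twisted_adjointM hU) star_A osa_dag_inv. Qed.

Lemma comp_starX_X x y : bl_comp (star (pX x)) (pX y) = pB (oc_pair x y).
Proof. exact: sr_pair. Qed.

(** The action of finite rank operators on the module: x (x) y^dagger sends w to x <y, w>. *)
Lemma comp_tensor_X z w : exists x, bl_comp (tensor_rep z) (pX w) = pX x.
Proof.
elim/tensor_ind: z => [|x [y] z [x' IH]].
  by exists 0; rewrite tensor_rep0 bl_comp0l sr_X0.
exists (oc_ract x (oc_pair y w) + x').
by rewrite tensor_repD bl_compDl IH tensor_rep_tens -bl_compA comp_starX_X sr_XD sr_ract.
Qed.

Lemma star_tensor z : exists z', star (tensor_rep z) = tensor_rep z'.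
Proof.
elim/tensor_ind: z => [|x [y] z [z' IH]].
  by exists 0; rewrite tensor_rep0 star0.
exists (tens y (Adj x) + z').
by rewrite !tensor_repD starD IH !tensor_rep_tens (twisted_adjointM hU) (twisted_adjointK hU).
Qed.

(** The mirror image of [comp_tensor_X] under [star], which reverses products. *)
Lemma comp_starX_tensor y z : exists y', bl_comp (star (pX y)) (tensor_rep z) = star (pX y').
Proof.
have [z' zz'] := star_tensor z; have [x xP] := comp_tensor_X z' y.
by exists x; rewrite -xP (twisted_adjointM hU) -zz' (twisted_adjointK hU).
Qed.

Lemma comp_tensor_tensor z z' :
  exists z'', bl_comp (tensor_rep z) (tensor_rep z') = tensor_rep z''.
Proof.
elim/tensor_ind: z => [|x [y] z [z'' IH]].
  by exists 0; rewrite tensor_rep0 bl_comp0l.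
have [y' yP] := comp_starX_tensor y z'.
exists (tens x (Adj y') + z'').
by rewrite !tensor_repD bl_compDl IH !tensor_rep_tens -bl_compA yP.
Qed.

Lemma comp_A_tensor a z : exists z', bl_comp (pA a) (tensor_rep z) = tensor_rep z'.
Proof.
elim/tensor_ind: z => [|x [y] z [z' IH]].
  by exists 0; rewrite tensor_rep0 bl_comp0r.
exists (tens (oc_lact a x) (Adj y) + z').
by rewrite !tensor_repD bl_compDr IH !tensor_rep_tens bl_compA sr_lact.
Qed.

Lemma comp_tensor_A z a : exists z', bl_comp (tensor_rep z) (pA a) = tensor_rep z'.
Proof.
have [z1 z1P] := star_tensor z; have [z2 z2P] := comp_A_tensor (osa_dag a) z1.
have [z3 z3P] := star_tensor z2; exists z3.
by rewrite -z3P -z2P (twisted_adjointM hU) star_A osa_dag_inv -z1P (twisted_adjointK hU).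
Qed.

(* Only finite sums of elementary tensors in the lower right corner: on these
   the closure properties are purely algebraic, and the norm closure is still
   the whole linking algebra. *)
Definition linking_core : set (BL (dsum H)) :=
  [set T | exists a b x y z,
     T = block_op (pB b) (star (pX y)) (pX x) (pA a + tensor_rep z)].

Notation starL := (twisted_adjoint (linking_U pi)).

Lemma linking_core_subspace : linear_subspace linking_core.
Proof.
split.
  exists 0, 0, 0, 0, 0.
  rewrite (linear_fun_0 pA_linear) (linear_fun_0 pB_linear) sr_X0 tensor_rep0 star0 addr0.
  by apply: bl_ext => x; rewrite /= /block_fun /= !addr0.
move=> c _ _ [a [b [x [y [z ->]]]]] [a' [b' [x' [y' [z' ->]]]]].
(* [star] conjugates scalars, hence [c^*] in front of [y]. *)
exists (c *: a + a'), (c *: b + b'), (c *: x + x'), (c^* *: y + y'), (c *: z + z').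
rewrite block_op_linear pA_linear pB_linear !pX_linear tensor_rep_linear.
by rewrite twisted_adjoint_conj_linear conjCK scalerDr addrACA.
Qed.

Lemma linking_core_comp S T : linking_core S -> linking_core T ->
  linking_core (bl_comp S T).
Proof.
move=> [a [b [x [y [z ->]]]]] [a' [b' [x' [y' [z' ->]]]]].
have [y1 y1P] := comp_starX_tensor y z'; have [x1 x1P] := comp_tensor_X z x'.
have [z1 z1P] := comp_A_tensor a z'; have [z2 z2P] := comp_tensor_A z a'.
have [z3 z3P] := comp_tensor_tensor z z'.
(* The witnesses are the entries of the block product. In the lower right corner only [a a'] stays
   in the image of [A]; the term pi(x) star(pi(y')) and the three products involving [z] or [z'] are
   tensors. *)
exists (osa_mul a a'), (osa_mul b b' + oc_pair y x'),
  (oc_ract x b' + (oc_lact a x' + x1)),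
  (oc_ract y' (osa_dag b) + (oc_lact (osa_dag a') y + y1)),
  (tens x (Adj y') + (z1 + (z2 + z3))).
rewrite block_op_comp !bl_compDl !bl_compDr.
rewrite comp_B_starX comp_starX_A comp_starX_X -sr_ract -sr_lact -sr_B_mul -sr_A_mul.
rewrite y1P x1P z1P z2P z3P -tensor_rep_tens (linear_fun_D pB_linear) !sr_XD !starD !tensor_repD.
congr block_op; rewrite [RHS]addrCA; congr (_ + _).
by rewrite -!addrA; congr (_ + _); rewrite addrCA.
Qed.

Lemma linking_core_star T : linking_core T -> linking_core (starL T).
Proof.
move=> [a [b [x [y [z ->]]]]]; have [z' zP] := star_tensor z.
(* The block adjoint exchanges the off-diagonal corners, so [x] and [y] trade places. *)
exists (osa_dag a), (osa_dag b), y, x, z'.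
by rewrite twisted_adjoint_block_op (twisted_adjointK hU) starD star_A star_B zP.
Qed.

Lemma bh_quot_norm_le (t : bh_tensor K) :
  norm1 (os_norm K) (bh_quot (b := K) t) <= norm1 (os_norm (bh_tensor K)) t.
Proof.
have hT := os_axioms (bh_tensor K).
rewrite [leLHS]/norm1 -map_const_mx bh_quot_norm.
apply: ge_inf; last first.
  (* The zero matrix is an admissible kernel perturbation, and its term is the norm of [t]. *)
  exists 0; last by rewrite addr0.
  move=> i j; rewrite mxE; apply: (sub_closure hT).
  by move=> W [W0 _] _.
by exists 0 => _ [w _ <-]; exact: os_norm_ge0.
Qed.

(** A contractive surjection maps the dense algebraic tensor product onto a dense set. *)
Lemma tensor_compacts_dense k : norm_closure (norm1 (os_norm K)) (range tensor_compacts) k.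
Proof.
have [t _ <-] : range (bh_quot (b := K)) k by rewrite bh_quot_surj.
have tP : norm_closure (norm1 (os_norm (bh_tensor K))) (range (ht_incl (bh_tensor K))) t.
  by rewrite ht_incl_dense.
apply: (closure_image (os_axioms (bh_tensor K)) (c := 1) _ _ _ tP).
- exact: linear_fun_B (@bh_quot_linear _ _ _ _ _ _ _ _ K).
- by move=> x; rewrite mul1r bh_quot_norm_le.
- by move=> _ [z _ <-]; exists z.
Qed.

Lemma linking_algebraE :
  linking_algebra piK = norm_closure (norm1 (bl_mxnorm (dsum H))) linking_core.
Proof.
have hL := bl_operator_space (dsum H).
apply/seteqP; split; apply: (closure_sub hL); last first.
  move=> _ [a [b [x [y [z ->]]]]]; apply: (sub_closure hL).
  by exists a, b, x, y, (tensor_compacts z).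
move=> _ [a [b [x [y [k ->]]]]].
have [core0 coreD] := closure_subspace hL linking_core_subspace.
(* Only the corner entry [piK k] needs approximation; the other summand lies in the core, and the
   closure is a subspace. *)
have -> : linking_op piK a b x y k =
    1 *: block_op (pB b) (star (pX y)) (pX x) (pA a + tensor_rep 0) +
    block_op 0 0 0 (piK k).
  by rewrite block_op_linear !scale1r !addr0 tensor_rep0 addr0.
apply: coreD; first by apply: (sub_closure hL); exists a, b, x, y, 0.
have kP : norm_closure opn (range tensor_rep) (piK k).
  have [c cP] := cr_bounded hpiK.
  apply: (closure_image (os_axioms K) (c := c) _ _ _ (tensor_compacts_dense k)).
  - exact: linear_fun_B (cr_linear hpiK).
  - by move=> u; rewrite /norm1 -map_const_mx cP.
  - by move=> _ [z _ <-]; exists z.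
apply: (closure_image (bl_operator_space H) (c := 1) _ _ _ kP).
- move=> u v; rewrite -[- block_op _ _ _ v]scaleN1r [RHS]addrC block_op_linear.
  by rewrite !scaler0 !addr0 scaleN1r [- v + u]addrC.
- by move=> u; rewrite mul1r opnorm_block_corner.
- move=> _ [z _ <-]; exists 0, 0, 0, 0, z.
  by rewrite (linear_fun_0 pA_linear) (linear_fun_0 pB_linear) sr_X0 star0 add0r.
Qed.

End LinkingAlgebra.

Theorem lemma4p4 (R : realType) (A B : operatorStarAlgebra R)
    (X : correspondence A B) (pi : standard_rep X)
    (K : compacts X) (piK : K -> BL (sr_H pi)) (hpiK : is_compacts_rep piK) :
  exists (hL : linear_subspace (linking_algebra piK))
    (mulL : subspace hL -> subspace hL -> subspace hL)
    (dagL : subspace hL -> subspace hL)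
    (hstar : is_operator_star_algebra
               (sub_norm (bl_mxnorm (dsum (sr_H pi)))) mulL dagL),
    [/\ forall S T : subspace hL,
          subspace_val (mulL S T) = bl_comp (subspace_val S) (subspace_val T),
        forall T : subspace hL,
          subspace_val (dagL T) =
            bl_comp (linking_U pi) (bl_comp (adjoint (subspace_val T)) (linking_U pi))
      & is_standard_form_rep (L := OperatorStarAlgebra hstar)
          (H := dsum (sr_H pi)) (@subspace_val _ _ _ hL) (linking_U pi)].
Proof.
have hN := bl_operator_space (dsum (sr_H pi)).
have hU : selfadjoint_unitary (linking_U pi).
  exact: diag_selfadjoint_unitary (sr_unitary pi).
have LE := linking_algebraE hpiK.
have hL : linear_subspace (linking_algebra piK).
  by rewrite LE; exact: (closure_subspace hN (linking_core_subspace hpiK)).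
have closedL : norm_closure (norm1 (bl_mxnorm (dsum (sr_H pi)))) (linking_algebra piK)
    `<=` linking_algebra piK.
  (* The linking algebra is itself defined as a norm closure. *)
  exact: closure_idem.
have compL S T : linking_algebra piK S -> linking_algebra piK T ->
    linking_algebra piK (bl_comp S T).
  by rewrite LE; apply: closure_comp; exact: (linking_core_comp hpiK).
have dagL T : linking_algebra piK T ->
    linking_algebra piK (twisted_adjoint (linking_U pi) T).
  rewrite LE; apply: (closure_image hN (c := 1)).
  - exact: twisted_adjointB.
  - by move=> x; rewrite mul1r (opnorm_twisted_adjoint hU).
  - exact: (linking_core_star hpiK).
exists hL, (sub_comp (hS := hL) compL), (sub_dag (hS := hL) dagL).
(* The formulas for product and involution hold by definition of [sub_comp] and [sub_dag]. *)
exists (sub_operator_star_algebra hU hL closedL compL dagL); split=> //.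
exact: sub_standard_form_rep.
Qed.
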